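(* For all integers $\alpha \geq 1$ and $n \geq 0$, \[a_3\left(5^{2\alpha}n +\gamma_{\alpha} \right) \equiv 0 \pmod{5^\alpha},\] where $\gamma_{\alpha}$ is the integer \[\gamma_{\alpha} = 20 + \frac{19 \cdot 25 \,(25^{\alpha-1}-1)}{24}.\]
   Context: For a positive integer $d$, $a_d(n)$ denotes the number of partitions of $n$ in which the odd parts are unrestricted and each even part may independently be assigned one of $d$ colors (generalized cubic partitions). Equivalently, $\sum_{n\ge 0} a_3(n)q^n = \prod_{k\ge1}\frac{1}{(1-q^k)(1-q^{2k})^2}$. *)

(* Defs.v *)
From mathcomp Require Import all_boot.

Set Implicit Arguments.
Unset Strict Implicit.
Unset Printing Implicit Defensive.

(* A coloured part is a pair (k, c) of a size k and a colour c.  Odd sizes come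
   in one colour only, represented by the colour 0 (which exists as soon as the
   number d of colours is positive); even sizes may take any colour c < d. *)
Definition coloured_part (k c : nat) : bool := (0 < k) && (odd k ==> (c == 0)).

(* A coloured partition of n is given by the multiplicities m (k, c) of its
   coloured parts.  Bounding sizes and multiplicities by n loses nothing, since
   k * m (k, c) <= n with k > 0 and m (k, c) > 0 forces both to be at most n. *)
Definition cubic_partition (d n : nat)
    (m : {ffun 'I_n.+1 * 'I_d -> 'I_n.+1}) : bool :=
  [forall p : 'I_n.+1 * 'I_d, (0 < m p) ==> coloured_part p.1 p.2] &&
  (\sum_(p : 'I_n.+1 * 'I_d) p.1 * m p == n).

(* The counting function a_d(n) of the generalized cubic partitions, for d > 0. *)
Definition num_cubic_partitions (d n : nat) : nat :=
  #|[set m | @cubic_partition d n m]|.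

(* The division is exact, as 24 divides 25 ^ j - 1, and for 0 < alpha neither
   subtraction truncates. *)
Definition gamma (alpha : nat) : nat :=
  20 + (19 * 25 * (25 ^ (alpha - 1) - 1)) %/ 24.

(* Main.v *)
(* Let [f] be Euler's product, [f_d = f (q ^ d)], and let [U] keep the coefficients whose index is
   divisible by 5. With [A = q ^ 5 f_25 f_50 ^ 2 / (f_1 f_2 ^ 2)], the series [L_0 = 1] and
   [L_k = f_1 f_2 ^ 2 * sum_n a_3 (25 ^ k n + gamma_k) q ^ (n + 1)] for [k > 0] satisfy
   [L_(k+1) = U (U (A L_k))]. All of them are power series with integer coefficients in
   [s = q f_10 ^ 4 f_1 ^ 2 / (f_2 ^ 4 f_5 ^ 2)], a Hauptmodul of Gamma_0(10).

   The 5-dissections of [f_1] and [f_2] follow from three sparse series (Euler's [f_1], Jacobi's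
   [f_1 ^ 3] and Gauss' [f_2 ^ 2 / f_1], each missing some residues modulo 5); they involve two
   series [u] and [v] with [v - u ^ 2 = u v ^ 2 (v + u ^ 2)] (the Rogers-Ramanujan continued
   fractions of [q ^ 5] and [q ^ 10]), and [k = u v ^ 2] parametrizes
   [s (q ^ 5) = k / (1 + k - k ^ 2)]. Modulo this relation one checks an equation of degree 5 over
     [Z[s (q ^ 5)]] for [z], where
   [z ^ 2 = s (q) s (q ^ 5)], and an expansion of [A] in powers of [z]. They give recurrences for
   [U (s ^ m)] and [U (A s ^ m)], whence 5-adic valuations that grow linearly with the exponent
   of [s]. These matrices map a lattice of even steps into a lattice of odd steps, cut out by one
     linear
   condition modulo 5 which forces the next application of [U] to gain a factor 5. *)

Require Import Defs.
From mathcomp Require Import all_boot all_algebra all_field.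
From mathcomp Require Import boolp zify ring.
From HB Require Import structures.

Set Implicit Arguments.
Unset Strict Implicit.
Unset Printing Implicit Defensive.

Import GRing.Theory Num.Theory.
Local Open Scope ring_scope.

(** * Formal power series *)

Record fps (R : Type) := Fps { coefs :> nat -> R }.

HB.instance Definition _ (R : Type) := gen_eqMixin (fps R).
HB.instance Definition _ (R : Type) := gen_choiceMixin (fps R).

Lemma fpsP (R : Type) (f g : fps R) : f =1 g -> f = g.
Proof. by case: f g => [f] [g] /= /funext ->. Qed.

Lemma coefsE (R : Type) (F : nat -> R) n : Fps F n = F n.
Proof. by []. Qed.

Section FpsRing.
Variable R : comNzRingType.
Implicit Types f g h : fps R.

Definition fps_zero : fps R := Fps (fun=> 0).
Definition fps_one : fps R := Fps (fun n => (n == 0%N)%:R).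
Definition fps_opp f := Fps (fun n => - f n).
Definition fps_add f g := Fps (fun n => f n + g n).
Definition fps_mul f g := Fps (fun n => \sum_(i < n.+1) f i * g (n - i)%N).
Definition fps_trunc N f : {poly R} := \poly_(i < N) f i.

Lemma fps_addA : associative fps_add.
Proof. by move=> f g h; apply: fpsP => n /=; rewrite addrA. Qed.

Lemma fps_addC : commutative fps_add.
Proof. by move=> f g; apply: fpsP => n /=; rewrite addrC. Qed.

Lemma fps_add0 : left_id fps_zero fps_add.
Proof. by move=> f; apply: fpsP => n /=; rewrite add0r. Qed.

Lemma fps_addN : left_inverse fps_zero fps_opp fps_add.
Proof. by move=> f; apply: fpsP => n /=; rewrite addNr. Qed.

HB.instance Definition _ :=
  GRing.isZmodule.Build (fps R) fps_addA fps_addC fps_add0 fps_addN.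

(** Coefficients below [N] see only truncations, so commutativity and associativity of the product
    are inherited from polynomials. *)
Lemma fps_mul_trunc N f g n : (n < N)%N ->
  fps_mul f g n = (fps_trunc N f * fps_trunc N g)`_n.
Proof.
move=> ltnN; rewrite coefM; apply: eq_bigr => i _.
by rewrite !coef_poly !ifT //; have := ltn_ord i; lia.
Qed.

Lemma fps_mulC : commutative fps_mul.
Proof.
by move=> f g; apply: fpsP => n; rewrite !(@fps_mul_trunc n.+1) // mulrC.
Qed.

Lemma fps_mulA : associative fps_mul.
Proof.
have trE f g h n : fps_mul f (fps_mul g h) n
    = (fps_trunc n.+1 f * (fps_trunc n.+1 g * fps_trunc n.+1 h))`_n.
  rewrite coefM; apply: eq_bigr => i _.
  have := ltn_ord i; rewrite coef_poly => -> .
  by rewrite (@fps_mul_trunc n.+1) // ltnS leq_subr.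
move=> f g h; apply: fpsP => n; rewrite trE [fps_mul _ h]fps_mulC trE.
by rewrite mulrA mulrC.
Qed.

Lemma fps_mul1 : left_id fps_one fps_mul.
Proof.
move=> f; apply: fpsP => n /=.
rewrite big_ord_recl /= mul1r subn0 big1 ?addr0 // => i _.
by rewrite mul0r.
Qed.

Lemma fps_mulDl : left_distributive fps_mul fps_add.
Proof.
move=> f g h; apply: fpsP => n /=; rewrite -big_split /=.
by apply: eq_bigr => i _; rewrite mulrDl.
Qed.

Lemma fps_one_neq0 : fps_one != 0 :> fps R.
Proof.
by apply/eqP => /(congr1 (fun f : fps R => f 0%N)) /eqP; rewrite oner_eq0.
Qed.

HB.instance Definition _ := GRing.Zmodule_isComNzRing.Build (fps R)
  fps_mulA fps_mulC fps_mul1 fps_mulDl fps_one_neq0.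

Definition fpsX : fps R := Fps (fun n => (n == 1%N)%:R).

Arguments coefs : simpl never.

Lemma fps0E n : (0 : fps R) n = 0. Proof. by []. Qed.
Lemma fps1E n : (1 : fps R) n = (n == 0%N)%:R. Proof. by []. Qed.
Lemma fpsDE f g n : (f + g) n = f n + g n. Proof. by []. Qed.
Lemma fpsNE f n : (- f) n = - f n. Proof. by []. Qed.
Lemma fpsBE f g n : (f - g) n = f n - g n. Proof. by []. Qed.
Lemma fpsME f g n : (f * g) n = \sum_(i < n.+1) f i * g (n - i)%N.
Proof. by []. Qed.

Lemma fpsM0E f g : (f * g) 0%N = f 0%N * g 0%N.
Proof. by rewrite fpsME big_ord1. Qed.

Lemma fpsX0E f n : (f ^+ n) 0%N = f 0%N ^+ n.
Proof. by elim: n => [|n IH]; rewrite ?expr0 // !exprS fpsM0E IH. Qed.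

Lemma fps_sumE (I : Type) (r : seq I) (P : pred I) (F : I -> fps R) n :
  (\sum_(i <- r | P i) F i) n = \sum_(i <- r | P i) F i n.
Proof. by elim/big_rec2: _ => // i a f _ <-. Qed.

Lemma fpsMnE f m n : (f *+ m) n = f n *+ m.
Proof. by elim: m => // m IH; rewrite !mulrS fpsDE IH. Qed.

Lemma fps_natME m f n : (m%:R * f) n = m%:R * f n.
Proof. by rewrite !mulr_natl fpsMnE. Qed.

Lemma fpsXME f n : (fpsX * f) n = if n is m.+1 then f m else 0.
Proof.
rewrite fpsME; case: n => [|n]; first by rewrite big_ord1 mul0r.
rewrite big_ord_recl /= mul0r add0r big_ord_recl /= mul1r big1 ?addr0.
  by congr (f _); rewrite /bump /=; lia.
by move=> i _; rewrite mul0r.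
Qed.

Lemma fpsXnME m f n : (fpsX ^+ m * f) n = if (m <= n)%N then f (n - m)%N else 0.
Proof.
elim: m n => [|m IH] n; first by rewrite expr0 mul1r subn0.
by rewrite exprS -mulrA fpsXME; case: n => //= n; rewrite IH.
Qed.

Lemma fpsXnE m n : (fpsX ^+ m) n = (n == m)%:R.
Proof.
rewrite -[fpsX ^+ m]mulr1 fpsXnME fps1E subn_eq0.
by rewrite eqn_leq; case: leqP; rewrite ?andbT ?andbF.
Qed.

Lemma fpsXM_inj m f g : fpsX ^+ m * f = fpsX ^+ m * g -> f = g.
Proof.
move=> E; apply: fpsP => n.
by have := congr1 (fun h : fps R => h (n + m)%N) E; rewrite !fpsXnME leq_addl addnK.
Qed.

(** * Congruences modulo a power of the variable *)

Definition eqX N f g := forall n, (n < N)%N -> f n = g n.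

Lemma eqX_refl N f : eqX N f f. Proof. by []. Qed.
Lemma eqX_sym N f g : eqX N f g -> eqX N g f.
Proof. by move=> E n /E ->. Qed.
Lemma eqX_trans N g f h : eqX N f g -> eqX N g h -> eqX N f h.
Proof. by move=> E E' n ltnN; rewrite E ?E'. Qed.
Lemma eqX_leq M N f g : (M <= N)%N -> eqX N f g -> eqX M f g.
Proof. by move=> leMN E n ltnM; apply: E; apply: leq_trans leMN. Qed.
(** Takes the place of limits: an identity between infinite products is proved modulo each power of
    the variable, from a finite identity. *)
Lemma eqXP f g : (forall N, eqX N f g) -> f = g.
Proof. by move=> E; apply: fpsP => n; apply: (E n.+1). Qed.
Lemma eqXD N f g f' g' : eqX N f f' -> eqX N g g' -> eqX N (f + g) (f' + g').
Proof. by move=> E E' n ltnN; rewrite !fpsDE E ?E'. Qed.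
Lemma eqXM N f g f' g' : eqX N f f' -> eqX N g g' -> eqX N (f * g) (f' * g').
Proof.
move=> E E' n ltnN; rewrite !fpsME; apply: eq_bigr => i _.
by have := ltn_ord i => lti; rewrite E ?E' //; lia.
Qed.
Lemma eqX_exp N f g m : eqX N f g -> eqX N (f ^+ m) (g ^+ m).
Proof. by move=> E; elim: m => // m IH; rewrite !exprS; apply: eqXM. Qed.
Lemma eqX_sum N (I : Type) (r : seq I) (P : pred I) (F G : I -> fps R) :
  (forall i, P i -> eqX N (F i) (G i)) ->
  eqX N (\sum_(i <- r | P i) F i) (\sum_(i <- r | P i) G i).
Proof. by move=> E; elim/big_rec2: _ => // i f g /E; apply: eqXD. Qed.
Lemma eqX_prod N (I : Type) (r : seq I) (P : pred I) (F G : I -> fps R) :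
  (forall i, P i -> eqX N (F i) (G i)) ->
  eqX N (\prod_(i <- r | P i) F i) (\prod_(i <- r | P i) G i).
Proof. by move=> E; elim/big_rec2: _ => // i f g /E; apply: eqXM. Qed.

Lemma eqX0M M N f g : eqX M f 0 -> eqX N g 0 -> eqX (M + N) (f * g) 0.
Proof.
move=> E E' n ltn; rewrite fpsME big1 // => i _.
have [ltiM|leMi] := ltnP i M; first by rewrite E ?mul0r.
by rewrite E' ?mulr0 //; have := ltn_ord i; lia.
Qed.

Lemma eqX0_mull N f g : eqX N g 0 -> eqX N (f * g) 0.
Proof. by move=> E; apply: (@eqX0M 0). Qed.

Lemma eqX0_sum N (I : Type) (r : seq I) (P : pred I) (F : I -> fps R) :
  (forall i, P i -> eqX N (F i) 0) -> eqX N (\sum_(i <- r | P i) F i) 0.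
Proof. by move=> E n ltnN; rewrite fps_sumE big1 // => i /E ->. Qed.

Lemma eqX0_exp f m : f 0%N = 0 -> eqX m (f ^+ m) 0.
Proof.
move=> f0; elim: m => [//|m IH]; rewrite exprS -[m.+1]add1n.
by apply: eqX0M => // -[].
Qed.

Lemma eqX0_Xn N m : (N <= m)%N -> eqX N (fpsX ^+ m) 0.
Proof.
by move=> leNm n ltnN; rewrite fpsXnE fps0E; case: eqP => // E; lia.
Qed.

End FpsRing.
Arguments coefs : simpl never.
Arguments fpsX {R}.
Arguments eqX_refl {R N f}.

Section Subst.
Variable R : comNzRingType.
Implicit Types f g h : fps R.
(** * Substitution of a series without constant term *)

Definition fpsC (a : R) : fps R := Fps (fun n => a *+ (n == 0%N)).

Lemma fpsCME a f n : (fpsC a * f) n = a * f n.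
Proof.
rewrite fpsME big_ord_recl coefsE mulr1n subn0 big1 ?addr0 // => i _.
by rewrite coefsE mul0r.
Qed.

Lemma fpsCB : {morph fpsC : a b / a - b}.
Proof. by move=> a b; apply: fpsP => n; rewrite fpsBE !coefsE mulrnBl. Qed.

Lemma fpsC1 : fpsC 1 = 1. Proof. by []. Qed.

Lemma fpsCM : {morph fpsC : a b / a * b}.
Proof. by move=> a b; apply: fpsP => n; rewrite fpsCME !coefsE mulrnAr. Qed.

HB.instance Definition _ := GRing.isZmodMorphism.Build R (fps R) fpsC fpsCB.
HB.instance Definition _ := GRing.isMonoidMorphism.Build R (fps R) fpsC (conj fpsC1 fpsCM).

(** When [h] has no constant term, [h ^+ m] starts in degree [m] at least, so cutting the sum at [n]
    loses nothing. *)
Definition fps_comp h (c : fps R) : fps R :=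
  Fps (fun n => \sum_(m < n.+1) c m * (h ^+ m) n).

Lemma fps_compE h c n : fps_comp h c n = \sum_(m < n.+1) c m * (h ^+ m) n.
Proof. by []. Qed.

Section Comp.
Variable h : fps R.
Hypothesis h0 : h 0%N = 0.
Local Notation K := (fps_comp h).

Lemma comp_eqX N c : eqX N (K c) (\sum_(m < N) fpsC (c m) * h ^+ m).
Proof.
move=> n ltnN; rewrite fps_sumE fps_compE.
rewrite (big_ord_widen N (fun m => c m * (h ^+ m) n)) // big_mkcond /=.
apply: eq_bigr => m _; rewrite fpsCME; case: ifP => // /negbT.
by rewrite -leqNgt => ltnm; rewrite (eqX0_exp h0) ?mulr0.
Qed.

Lemma compD c d : K (c + d) = K c + K d.
Proof.
by apply: fpsP => n; rewrite fpsDE !fps_compE -big_split; apply: eq_bigr => m _; rewrite mulrDl.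
Qed.

Lemma comp1 : K 1 = 1.
Proof.
apply: fpsP => n; rewrite fps_compE big_ord_recl big1 ?addr0 ?mul1r ?expr0 // => i _.
by rewrite mul0r.
Qed.

Lemma compXM c : K (fpsX * c) = h * K c.
Proof.
apply: eqXP => N; apply: eqX_trans (eqX_leq (leqnSn N) (comp_eqX _)) _.
rewrite big_ord_recl fpsXME.
have -> : fpsC 0 * h ^+ 0 = 0 :> fps R.
  by apply: fpsP => n; rewrite fpsCME mul0r.
rewrite add0r; apply: eqX_trans (eqXM eqX_refl (eqX_sym (@comp_eqX N c))).
rewrite mulr_sumr => n _; congr (coefs _ n); apply: eq_bigr => i _.
by rewrite fpsXME mulrCA exprS.
Qed.

Lemma compCM a c : K (fpsC a * c) = fpsC a * K c.
Proof.
apply: fpsP => n; rewrite fpsCME !fps_compE mulr_sumr.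
by apply: eq_bigr => m _; rewrite fpsCME mulrA.
Qed.

Lemma eqX_comp N c d : eqX N c d -> eqX N (K c) (K d).
Proof.
move=> E n ltnN; rewrite !fps_compE; apply: eq_bigr => m _.
by rewrite E //; have := ltn_ord m; lia.
Qed.

Lemma comp0 : K 0 = 0.
Proof. by apply: fpsP => n; rewrite fps_compE big1 // => m _; rewrite mul0r. Qed.

Lemma comp_sum (I : Type) (r : seq I) (P : pred I) (F : I -> fps R) :
  K (\sum_(i <- r | P i) F i) = \sum_(i <- r | P i) K (F i).
Proof. exact: (big_morph K compD comp0). Qed.

Lemma compXn m c : K (fpsX ^+ m * c) = h ^+ m * K c.
Proof. by elim: m => [|m IH]; rewrite ?expr0 ?mul1r // !exprS -!mulrA compXM IH. Qed.

Lemma fps_trunc_eqX N c : eqX N c (\sum_(m < N) fpsC (c m) * fpsX ^+ m).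
Proof.
move=> n ltnN; rewrite fps_sumE (bigD1 (Ordinal ltnN)) //= fpsCME fpsXnE eqxx.
rewrite mulr1 big1 ?addr0 // => i /negbTE neq; rewrite fpsCME fpsXnE.
by rewrite eq_sym -(inj_eq val_inj) /= in neq *; rewrite neq mulr0.
Qed.

Lemma compM c d : K (c * d) = K c * K d.
Proof.
apply: eqXP => N.
apply: eqX_trans (eqX_comp (eqXM (fps_trunc_eqX (N := N) c) eqX_refl)) _.
rewrite mulr_suml comp_sum.
rewrite (eq_bigr (fun m : 'I_N => fpsC (c m) * h ^+ m * K d)); last first.
  by move=> m _; rewrite -!mulrA compCM compXn.
by rewrite -mulr_suml; apply: eqXM => //; apply/eqX_sym/comp_eqX.
Qed.

Lemma compX : K fpsX = h.
Proof. by rewrite -[fpsX]mulr1 compXM comp1 mulr1. Qed.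

End Comp.

(** The geometric series in [1 - f], which inverts [f] when the constant term of [f] is 1. *)
Definition fps_inv f : fps R := fps_comp (1 - f) (Fps (fun=> 1)).

Lemma fps_mulfV f : f 0%N = 1 -> f * fps_inv f = 1.
Proof.
move=> f0; have h0 : (1 - f) 0%N = 0 by rewrite fpsBE fps1E f0 subrr.
have E : fps_inv f = 1 + (1 - f) * fps_inv f.
  have {1}-> : fps_inv f = fps_comp (1 - f) (1 + fpsX * Fps (fun=> 1)).
    congr fps_comp; apply: fpsP => n; rewrite fpsDE fpsXME fps1E.
    by case: n => [|n]; rewrite coefsE ?addr0 ?add0r.
  by rewrite compD comp1 compXM.
have -> : f * fps_inv f = fps_inv f - (1 - f) * fps_inv f by ring.
by rewrite {1}E addrK.
Qed.

Lemma fps_inv0 f : f 0%N = 1 -> fps_inv f 0%N = 1.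
Proof.
move=> f0; have := congr1 (fun g : fps R => g 0%N) (fps_mulfV f0).
by rewrite /= fpsM0E f0 mul1r => ->.
Qed.

Lemma fps_mulfI f g h : f 0%N = 1 -> f * g = f * h -> g = h.
Proof.
by move=> f0 /(congr1 (fun k => fps_inv f * k)); rewrite !mulrA [_ * f]mulrC fps_mulfV // !mul1r.
Qed.

Lemma eqX_mulfI N f g h : f 0%N = 1 -> eqX N (f * g) (f * h) -> eqX N g h.
Proof.
move=> f0 E; have K k : k = fps_inv f * (f * k).
  by rewrite mulrA [_ * f]mulrC fps_mulfV ?mul1r.
by rewrite [g]K [h]K; apply: eqXM.
Qed.

(** * Dilation and dissection *)

Definition dil d f : fps R := Fps (fun n => if (d %| n)%N then f (n %/ d)%N else 0).

(** For [i = 0] this is Atkin's operator U_d; [dissect_dilM] is linearity over the series in q^d. *)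
Definition dissect d i f : fps R := Fps (fun n => f (d * n + i)%N).

Lemma dilE d f n : dil d f n = if (d %| n)%N then f (n %/ d)%N else 0.
Proof. by []. Qed.

Lemma dissectE d i f n : dissect d i f n = f (d * n + i)%N.
Proof. by []. Qed.

Lemma sum_dvdn d n i (F : nat -> R) : (i < d)%N ->
  \sum_(j < (d * n + i).+1 | (d %| j)%N) F j = \sum_(m < n.+1) F (d * m)%N.
Proof.
move=> ltid; elim: n => [|n IH].
  rewrite big_ord1 muln0 add0n big_mkcond big_ord_recl /= dvdn0 big1 ?addr0 //.
  move=> j _; rewrite /bump /= ifF //; apply/negbTE/negP => /dvdn_leq.
  by have := ltn_ord j; lia.
rewrite big_ord_recr -IH -!(big_mkord (dvdn d) F) /=.
have le1 : ((d * n + i).+1 <= d * n.+1)%N by lia.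
have le2 : (d * n.+1 <= (d * n.+1 + i).+1)%N by lia.
have nodvd a b : (d * n < a)%N -> (b <= d * n.+1)%N ->
    \sum_(a <= j < b | (d %| j)%N) F j = 0.
  move=> lea leb; rewrite big_nat_cond big1 // => j /andP[/andP[leaj ltjb]].
  by case/dvdnP=> k Ek; have [lekn|ltnk] := leqP k n; nia.
rewrite (big_cat_nat (leq0n _) (leq_trans le1 le2)) /=; congr (_ + _).
rewrite (big_cat_nat le1 le2) /= nodvd ?add0r //; last lia.
rewrite big_ltn_cond ?dvdn_mulr //; last lia.
rewrite [X in F _ + X](_ : _ = 0) ?addr0 // big_nat_cond big1 //.
move=> j /andP[/andP[leaj ltjb]] /dvdnP[k Ek].
by have [lekn|ltnk] := leqP k n.+1; nia.
Qed.

Lemma dilB d f g : dil d (f - g) = dil d f - dil d g.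
Proof.
apply: fpsP => n; rewrite fpsBE !dilE fpsBE.
by case: ifP => // _; rewrite subrr.
Qed.

Lemma dil1 d : dil d 1 = 1.
Proof.
apply: fpsP => n; rewrite dilE !fps1E; case: ifP => [/dvdnP[k ->]|].
  have [-> | dgt0] := posnP d; first by rewrite divn0 muln0 eqxx.
  by rewrite mulnK // muln_eq0 [d == _]gtn_eqF ?orbF.
by case: n => [|//]; rewrite dvdn0.
Qed.

Lemma dilM d f g : dil d (f * g) = dil d f * dil d g.
Proof.
apply: fpsP => n; rewrite fpsME dilE.
have [/dvdnP[k Ek] | ndvd] := boolP (d %| n)%N; last first.
  rewrite big1 // => i _; rewrite !dilE.
  have [dvdi|] := boolP (d %| i)%N; last by rewrite mul0r.
  have lein : (i <= n)%N by rewrite -ltnS.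
  by rewrite dvdn_subl // (negbTE ndvd) mulr0.
have [d0|dgt0] := posnP d.
  move: Ek; rewrite d0 muln0 => ->.
  by rewrite big_ord1 fpsM0E !dilE.
rewrite Ek mulnK // fpsME.
transitivity (\sum_(i < (d * k + 0).+1 | (d %| i)%N)
    f (i %/ d)%N * g ((k * d - i) %/ d)%N).
  rewrite (@sum_dvdn d k 0 (fun i => f (i %/ d)%N * g ((k * d - i) %/ d)%N)) //.
  apply: eq_bigr => m _; rewrite mulKn // [(k * d)%N]mulnC -mulnBr mulKn //.
rewrite addn0 [(d * k)%N]mulnC big_mkcond; apply: eq_bigr => i _; rewrite !dilE.
have [dvdi|] := boolP (d %| i)%N; last by rewrite mul0r.
have lein : (i <= k * d)%N by rewrite -ltnS.
by rewrite dvdn_subl // dvdn_mull.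
Qed.

HB.instance Definition _ d := GRing.isZmodMorphism.Build (fps R) (fps R) (dil d) (@dilB d).
HB.instance Definition _ d := GRing.isMonoidMorphism.Build (fps R) (fps R) (dil d)
  (conj (@dil1 d) (@dilM d)).

Lemma dilX d : (0 < d)%N -> dil d fpsX = fpsX ^+ d.
Proof.
move=> dgt0; apply: fpsP => n; rewrite dilE fpsXnE coefsE.
case: ifP => [/dvdnP[k ->]|].
  by rewrite mulnK // -{2}[d]mul1n eqn_pmul2r.
by case: eqP => // ->; rewrite dvdnn.
Qed.

Lemma dilK d : (0 < d)%N -> injective (dil d).
Proof.
move=> dgt0 f g E; apply: fpsP => n.
have := congr1 (fun h : fps R => h (n * d)%N) E.
by rewrite /= !dilE dvdn_mull // mulnK.
Qed.

Lemma dil_dil a b f : (0 < a)%N -> dil a (dil b f) = dil (a * b) f.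
Proof.
move=> agt0; apply: fpsP => n; rewrite !dilE.
have [/dvdnP[k ->] | ndvd] := boolP (a %| n)%N.
  by rewrite mulnK // [(k * a)%N]mulnC dvdn_pmul2l // divnMl.
by rewrite ifF //; apply: contraNF ndvd; apply: dvdn_trans (dvdn_mulr _ _).
Qed.

Lemma eqX_dil d N f g : eqX N f g -> eqX (d * N) (dil d f) (dil d g).
Proof.
move=> E n ltn; rewrite !dilE; case: ifP => // /dvdnP[k Ek].
by apply: E; nia.
Qed.

Lemma dil0E d f : dil d f 0%N = f 0%N.
Proof. by rewrite dilE dvdn0 div0n. Qed.

Lemma dissectB d i f g : dissect d i (f - g) = dissect d i f - dissect d i g.
Proof. by []. Qed.

HB.instance Definition _ d i :=
  GRing.isZmodMorphism.Build (fps R) (fps R) (dissect d i) (@dissectB d i).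

Lemma eqX_dissect d i N f g :
  (i < d)%N -> eqX (d * N) f g -> eqX N (dissect d i f) (dissect d i g).
Proof. by move=> ltid E n ltn; rewrite !dissectE E //; nia. Qed.

Lemma dissect_dilM d i f g : (i < d)%N ->
  dissect d i (dil d g * f) = g * dissect d i f.
Proof.
move=> ltid; have dgt0 : (0 < d)%N by lia.
apply: fpsP => n; rewrite dissectE !fpsME.
transitivity (\sum_(j < (d * n + i).+1 | (d %| j)%N) g (j %/ d)%N * f (d * n + i - j)%N).
  rewrite [RHS]big_mkcond; apply: eq_bigr => j _; rewrite dilE.
  by case: ifP => // _; rewrite mul0r.
rewrite (@sum_dvdn d n i (fun j => g (j %/ d)%N * f (d * n + i - j)%N)) //.
apply: eq_bigr => m _; rewrite mulKn // dissectE; congr (_ * f _).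
by have := ltn_ord m; nia.
Qed.

Lemma dissect_Xn d i j : (i < d)%N -> (j < d)%N ->
  dissect d i (fpsX ^+ j) = (i == j)%:R.
Proof.
move=> ltid ltjd; apply: fpsP => n; rewrite dissectE fpsXnE.
have [-> | neq] := eqVneq i j.
  rewrite fps1E; congr (nat_of_bool _)%:R.
  by apply/eqP/eqP; nia.
rewrite fps0E; case: eqP => // E; case/eqP: neq.
by have [n0|] := posnP n; nia.
Qed.

Lemma fps_dissect d f : (0 < d)%N ->
  f = \sum_(i < d) fpsX ^+ i * dil d (dissect d i f).
Proof.
move=> dgt0; apply: fpsP => n; rewrite fps_sumE.
have ltnd : (n %% d < d)%N by rewrite ltn_mod.
rewrite (bigD1 (Ordinal ltnd)) //= fpsXnME leq_mod big1 ?addr0.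
  rewrite dilE dissectE; set q := (n - _)%N.
  have -> : q = (n %/ d * d)%N by rewrite /q {1}(divn_eq n d) addnK.
  by rewrite dvdn_mull // mulnK // mulnC -divn_eq.
move=> i neq; rewrite fpsXnME dilE; case: ifP => // lein.
case: ifP => // /dvdnP[k Ek]; case/eqP: neq; apply: val_inj => /=.
have -> : n = (k * d + i)%N by lia.
by rewrite modnMDl modn_small.
Qed.

End Subst.

(** * Euler's product and the finite triple product *)

Section QBinomial.
Variable R : comNzRingType.
Implicit Types q Y Z : R.

Definition qpoch q n := \prod_(i < n) (1 - q ^+ i.+1).

(** The Gaussian binomial, by Pascal's rule so that nothing has to be divided. *)
Fixpoint qbin q (n j : nat) : R :=
  match n, j with
  | _, 0%N => 1
  | 0%N, _.+1 => 0
  | n'.+1, j'.+1 => qbin q n' j' + q ^+ j'.+1 * qbin q n' j'.+1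
  end.

Lemma qbin0 q n : qbin q n 0 = 1. Proof. by case: n. Qed.

Lemma qbin_gt q n j : (n < j)%N -> qbin q n j = 0.
Proof.
by elim: n j => [|n IH] [|j] //= ltnj; rewrite !IH ?mulr0 ?addr0 // ltnW.
Qed.

(** Gauss' q-binomial theorem: split off the factor [i = 0] and apply the induction hypothesis at
    [q * Z]. The form homogeneous in [Y] and [Z] avoids negative powers of [Z] in the triple
    product. *)
Lemma qbinomial q Y Z n :
  \prod_(i < n) (Y + q ^+ i * Z) =
  \sum_(j < n.+1) q ^+ 'C(j, 2) * qbin q n j * Z ^+ j * Y ^+ (n - j).
Proof.
have bump0 i : bump 0 i = i.+1 by [].
elim: n Z => [|n IH] Z; first by rewrite big_ord0 big_ord1 !mul1r.
rewrite big_ord_recl expr0 mul1r.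
rewrite (eq_bigr (fun i : 'I_n => Y + q ^+ i * (q * Z))); last first.
  by move=> i _; rewrite mulrA -exprSr.
rewrite IH mulrDl !mulr_sumr big_ord_recl [RHS]big_ord_recl /=.
rewrite !qbin0 !expr0 !mulr1 !mul1r !subn0 -exprS -addrA; congr (_ + _).
have -> : \sum_(i < n) Y * (q ^+ 'C(bump 0 i, 2) * qbin q n (bump 0 i) *
    (q * Z) ^+ bump 0 i * Y ^+ (n - bump 0 i)) =
  \sum_(i < n.+1) q ^+ 'C(i.+1, 2) * (q ^+ i.+1 * qbin q n i.+1) *
    Z ^+ i.+1 * Y ^+ (n - i).
  rewrite [RHS]big_ord_recr /= qbin_gt // !(mulr0, mul0r) addr0.
  apply: eq_bigr => i _; rewrite !bump0 exprMn.
  by rewrite (_ : n - i = (n - i.+1).+1)%N ?exprS; [ring | have := ltn_ord i; lia].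
rewrite -big_split; apply: eq_bigr => i _ /=.
rewrite !bump0 /= subSS binS bin1 addnC exprD exprMn !exprS; ring.
Qed.

Lemma qbin_qpoch q n j : (j <= n)%N ->
  qbin q n j * (qpoch q j * qpoch q (n - j)) = qpoch q n.
Proof.
have qS m : qpoch q m.+1 = qpoch q m * (1 - q ^+ m.+1) by rewrite /qpoch big_ord_recr.
elim: n j => [|n IH] [|j] // lejn; rewrite ?qbin0 ?subn0.
- by rewrite /qpoch !big_ord0 !mulr1.
- by rewrite mul1r {1}/qpoch big_ord0 mul1r.
rewrite /= subSS (qS n) mulrDl -/(qbin _ _ _) (qS j).
have -> : qbin q n j * (qpoch q j * (1 - q ^+ j.+1) * qpoch q (n - j)) =
    (1 - q ^+ j.+1) * qpoch q n by rewrite -(IH j) //; ring.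
have [ltjn | lenj] := ltnP j n; last first.
  have -> : j = n by lia.
  by rewrite qbin_gt // mulr0 mul0r addr0 mulrC.
rewrite -(qS j) (_ : n - j = (n - j.+1).+1)%N; last lia.
rewrite (qS (n - j.+1)%N) -(IH j.+1) //.
have -> : q ^+ n.+1 = q ^+ j.+1 * q ^+ (n - j.+1).+1.
  by rewrite -exprD; congr (_ ^+ _); lia.
ring.
Qed.

End QBinomial.

Lemma qbin_rmorph (R S : comNzRingType) (phi : {rmorphism R -> S}) (q : R) n j :
  phi (qbin q n j) = qbin (phi q) n j.
Proof.
elim: n j => [|n IH] [|j] /=; rewrite ?rmorph1 ?rmorph0 //.
by rewrite rmorphD rmorphM rmorphXn !IH.
Qed.

Arguments qbin : simpl never.

(* (j - n) (j - n - 1) / 2, with the integer difference j - n. *)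
Definition tri n j := if (j <= n)%N then 'C((n - j).+1, 2) else 'C(j - n, 2).

Lemma bin2_mul2 k : ('C(k.+1, 2) * 2 = k.+1 * k)%N.
Proof. by rewrite bin2 muln2 -[RHS]odd_double_half oddM /= andNb. Qed.

Lemma bin2_mul2' k : ('C(k, 2) * 2 + k = k * k)%N.
Proof. by case: k => // k; rewrite bin2_mul2; lia. Qed.

Lemma leq_bin2 k : (k <= 'C(k.+1, 2))%N.
Proof. by have := bin2_mul2 k; case: k => // k; nia. Qed.

(** Completes the square in the exponents of the q-binomial theorem, so that one power of q factors
    out of all terms. *)
Lemma triE n j : (j <= n + n)%N ->
  ('C(j, 2) + n * (n + n - j) = 'C(n, 2) + n * n + tri n j)%N.
Proof.
move=> lej; rewrite /tri; have := bin2_mul2' j; have := bin2_mul2' n.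
case: leqP => lejn.
  have := bin2_mul2 (n - j); nia.
have := bin2_mul2' (j - n); nia.
Qed.

Lemma prod_expr_ord (R : comNzRingType) (q : R) n : \prod_(i < n) q ^+ i = q ^+ 'C(n, 2).
Proof.
by elim: n => [|n IH]; rewrite ?big_ord0 // big_ord_recr /= IH -exprD binS bin1 addnC.
Qed.

(** The lower half of the factors gives the [1 + q ^+ i.+1 * Z], read backwards, and the upper half
    the [q ^+ i + Z]. The factor [1 + Z] is kept apart because it becomes 2 for Gauss' series and
    vanishes for Jacobi's. *)
Lemma qpoch_split (R : comNzRingType) (q Z : R) m (n := m.+1) :
  \prod_(i < n + n) (q ^+ n * Z + q ^+ i) =
  q ^+ ('C(n, 2) + n * n) * (1 + Z) *
  (\prod_(i < n) (1 + q ^+ i.+1 * Z) * \prod_(i < m) (q ^+ i.+1 + Z)).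
Proof.
rewrite big_split_ord /=.
have -> : \prod_(i < n) (q ^+ n * Z + q ^+ i) =
    q ^+ 'C(n, 2) * \prod_(i < n) (1 + q ^+ i.+1 * Z).
  rewrite [X in _ = _ * X](reindex_inj rev_ord_inj) /= -prod_expr_ord -big_split.
  apply: eq_bigr => i _; rewrite /= mulrDr mulr1 mulrA -exprD addrC.
  by congr (_ + q ^+ _ * Z); have := ltn_ord i; lia.
have -> : \prod_(i < n) (q ^+ n * Z + q ^+ (n + i)) =
    q ^+ (n * n) * \prod_(i < n) (q ^+ i + Z).
  have -> : q ^+ (n * n) = \prod_(i < n) q ^+ n by rewrite prodr_const card_ord exprM.
  rewrite -big_split.
  by apply: eq_bigr => i _; rewrite /= exprD mulrDr addrC.
rewrite [X in _ * (_ * X)]big_ord_recl /= expr0 exprD.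
by move: (\prod_(i < n) _) (\prod_(i < m) _) => A B; ring.
Qed.

Section Euler.
Variable R : comNzRingType.

(** The coefficient of index [n] no longer changes once the partial product has [n] factors. *)
Definition euler : fps R := Fps (fun n => qpoch fpsX n n).

Lemma qpoch_eqX N n : (N <= n)%N -> eqX N.+1 (qpoch fpsX n) euler.
Proof.
move=> leNn k ltkN; have lekn : (k <= n)%N by lia.
rewrite coefsE -(subnKC lekn); elim: (n - k)%N => [|m IH]; first by rewrite addn0.
rewrite addnS /qpoch big_ord_recr /= mulrBr mulr1 fpsBE -/(qpoch _ _) IH.
by rewrite mulrC fpsXnME ifF ?subr0 //; lia.
Qed.

Lemma qpoch0E n : qpoch (fpsX : fps R) n 0%N = 1.
Proof.
elim: n => [|n IH]; first by rewrite /qpoch big_ord0.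
rewrite /qpoch big_ord_recr /= -/(qpoch _ _) fpsM0E IH fpsBE fpsXnE fps1E.
by rewrite subr0 mulr1.
Qed.

Lemma euler0E : euler 0%N = 1.
Proof. exact: qpoch0E. Qed.

(** The Gaussian binomial tends to the inverse of Euler's product when [j] and [n + n - j] both
    grow. If [tri n j] is at least [N], both sides vanish modulo X^N; otherwise [j] is close enough
    to [n] for both indices to be at least [N]. *)
Lemma qbin_lim N n j : (N + N <= n)%N -> (j <= n + n)%N ->
  eqX N (euler * (fpsX ^+ tri n j * qbin fpsX (n + n) j)) (fpsX ^+ tri n j).
Proof.
move=> leNn lej; have [leN|ltN] := leqP N (tri n j).
  have E := @eqX0_Xn R _ _ leN.
  apply: eqX_trans (eqX_sym E); rewrite mulrCA -[0](mul0r (euler * qbin fpsX (n + n) j)).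
  exact: eqXM.
have [lej1 lej2] : (N <= j)%N /\ (N <= n + n - j)%N.
  move: ltN; rewrite /tri; have [lejn|lejn] := leqP j n.
    by have := leq_bin2 (n - j); lia.
  have [k Ek] : exists k, j = (n + k.+1)%N by exists (j - n.+1)%N; lia.
  by rewrite Ek addKn; have := leq_bin2 k; lia.
rewrite mulrCA -{2}[fpsX ^+ _]mulr1; apply: eqXM => //.
apply: (eqX_mulfI euler0E); rewrite mulr1.
have lt k : (N <= k)%N -> eqX N (qpoch fpsX k) euler.
  by move=> leNk; apply: eqX_leq (leqnSn N) (qpoch_eqX leNk).
have lt2 : (N <= n + n)%N by lia.
apply: eqX_trans (lt _ lt2).
rewrite -(qbin_qpoch _ lej) [X in eqX _ X _](_ : _ = qbin fpsX (n + n) j * (euler * euler)).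
  by apply: eqXM => //; apply: eqXM; apply/eqX_sym/lt.
by ring.
Qed.

End Euler.

(** * Supports modulo 5 *)

(** The finite Jacobi triple product. The common power of q stays on both sides, to be cancelled
    once q is the variable. *)
Lemma triple_product (R : comNzRingType) (q Z : R) m (n := m.+1) :
  q ^+ ('C(n, 2) + n * n) *
    ((1 + Z) * (\prod_(i < n) (1 + q ^+ i.+1 * Z) * \prod_(i < m) (q ^+ i.+1 + Z))) =
  q ^+ ('C(n, 2) + n * n) *
    \sum_(j < (n + n).+1) q ^+ tri n j * qbin q (n + n) j * Z ^+ (n + n - j).
Proof.
rewrite [LHS]mulrA -qpoch_split mulr_sumr.
rewrite (eq_bigr (fun i : 'I_(n + n) => q ^+ n * Z + q ^+ i * 1)); last first.
  by move=> i _; rewrite mulr1.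
rewrite qbinomial; apply: eq_bigr => j _.
rewrite expr1n mulr1 exprMn -exprM !mulrA -exprD -triE; last by rewrite -ltnS.
by rewrite exprD; ring.
Qed.

(** Triangular numbers are 0, 1 or 3 modulo 5; this makes residues disappear from Gauss' and
    Jacobi's series. *)
Lemma bin2_mod5 k : ('C(k, 2) %% 5 != 2)%N && ('C(k, 2) %% 5 != 4)%N.
Proof.
have := bin2_mul2' k; move: 'C(k, 2) => c.
rewrite (divn_eq k 5); move: (k %/ 5)%N (k %% 5)%N (ltn_pmod k (isT : 0 < 5)%N) => a r.
case: r => [|[|[|[|[|//]]]]] _; move: (a * a)%N (mulnDl (a * 5) 0 (a * 5)) => A _ E;
apply/andP; split; apply/eqP => c5; nia.
Qed.

Lemma tri_mod5 n j : (tri n j %% 5 != 2)%N && (tri n j %% 5 != 4)%N.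
Proof. by rewrite /tri; case: ifP => _; apply: bin2_mod5. Qed.

(** Gauss' identity, from the triple product at [Z = 1]. The factor 2 is [1 + Z], and reflects that
    each triangular number is [tri n j] for two values of [j]. *)
Lemma psi_identity N (n := (N + N).+1) :
  eqX N (euler int * \sum_(j < (n + n).+1) fpsX ^+ tri n j) (2%:R * dil 2 (euler int) ^+ 2).
Proof.
have /fpsXM_inj := @triple_product (fps int) fpsX 1 (N + N).
rewrite -/n; under [X in _ = X -> _]eq_bigr do rewrite expr1n mulr1.
move=> E.
have qp2 k : \prod_(i < k) (1 + fpsX ^+ i.+1) * qpoch fpsX k = dil 2 (qpoch (fpsX : fps int) k).
  rewrite rmorph_prod -big_split; apply: eq_bigr => i _ /=.
  rewrite rmorphB rmorph1 rmorphXn /= dilX // -exprM mulnC exprM; ring.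
have limE k : (N <= k)%N -> eqX N (qpoch (fpsX : fps int) k) (euler int).
  by move=> leNk; apply: eqX_leq (leqnSn N) (qpoch_eqX _ leNk).
have limE2 k : (N <= k)%N -> eqX N (dil 2 (qpoch (fpsX : fps int) k)) (dil 2 (euler int)).
  by move=> leNk; apply: (eqX_leq (N := 2 * N)); [lia | apply: eqX_dil; apply: limE].
apply: (eqX_mulfI (euler0E _)).
apply: (@eqX_trans _ _ (euler int * (euler int * (euler int *
   \sum_(j < (n + n).+1) fpsX ^+ tri n j * qbin fpsX (n + n) j)))).
  apply: eqXM => //; apply: eqXM => //; rewrite mulr_sumr; apply: eqX_sum => j _.
  by apply/eqX_sym/qbin_lim; rewrite /n; have := ltn_ord j; rewrite /n; lia.
rewrite -E; set A := \prod_(i < n) _; set B := \prod_(i < N + N) _.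
have EA : A * qpoch fpsX n = dil 2 (qpoch fpsX n).
  by rewrite -qp2; congr (_ * _); apply: eq_bigr => i _; rewrite mulr1.
have EB : B * qpoch fpsX (N + N) = dil 2 (qpoch fpsX (N + N)).
  by rewrite -qp2; congr (_ * _); apply: eq_bigr => i _; rewrite addrC.
apply: (@eqX_trans _ _ (euler int * (2%:R * (dil 2 (qpoch fpsX n) * dil 2 (qpoch fpsX (N + N)))))).
  rewrite -EA -EB [X in eqX _ _ X](_ : _ = euler int * (qpoch fpsX n *
    (qpoch fpsX (N + N) * ((1 + 1) * (A * B))))); last by ring.
  apply: eqXM => //; apply: eqXM; first by apply/eqX_sym/limE; lia.
  by apply: eqXM => //; apply/eqX_sym/limE; lia.
apply: eqXM => //; apply: eqXM => //; rewrite expr2.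
by apply: eqXM; apply: limE2; lia.
Qed.

Lemma tri_sum_support (n : nat) (c : nat -> int) k : (k %% 5 == 2)%N || (k %% 5 == 4)%N ->
  (\sum_(j < (n + n).+1) fpsC (c j) * fpsX ^+ tri n j) k = 0.
Proof.
move=> k24; rewrite fps_sumE big1 // => j _; rewrite fpsCME fpsXnE.
have /andP[t2 t4] := tri_mod5 n j; case: eqP => [Ek|]; last by rewrite mulr0.
by move: k24; rewrite Ek (negbTE t2) (negbTE t4).
Qed.

Lemma psi_support k : (k %% 5 == 2)%N || (k %% 5 == 4)%N ->
  (dil 2 (euler int) ^+ 2 * fps_inv (euler int)) k = 0.
Proof.
move=> k24; apply/eqP; rewrite -(mulrI_eq0 _ (@mulfI int 2 isT)) -fps_natME mulrA.
have := @psi_identity k.+1; cbv zeta; set n := (k.+1 + k.+1).+1; set T := (X in eqX _ (_ * X) _)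
  => E.
apply/eqP; transitivity (T k).
  have -> : T = euler int * T * fps_inv (euler int).
    by rewrite -[LHS]mul1r -(fps_mulfV (euler0E int)); ring.
  by apply: (@eqXM _ k.+1) => //; apply/eqX_sym.
rewrite -(@tri_sum_support n (fun=> 1) k k24); congr (coefs _ k); rewrite /T.
by apply: eq_bigr => j _; apply: fpsP => i; rewrite fpsCME mul1r.
Qed.

(** The triple product at [Z = - 'X] is differentiated at ['X = 1]. As [1 - 'X] vanishes there, only
    the product of the other factors remains, which is two partial Euler products up to sign; the
    third comes from [qbin_lim]. *)
Lemma jacobi_identity N (n := (N + N).+1) :
  eqX N (euler int ^+ 3) (\sum_(j < (n + n).+1)
    fpsC ((-1) ^+ n * ((-1) ^+ (n + n - j) * (n + n - j)%:R)) * fpsX ^+ tri n j).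
Proof.
have derC (c : fps int) p : (c%:P * p)^`().[1] = c * p^`().[1].
  by rewrite derivM derivC mul0r add0r hornerM hornerC.
have := @triple_product {poly fps int} fpsX%:P (- 'X) (N + N); rewrite -/n.
move=> /(congr1 (fun p => p^`().[1])).
rewrite -rmorphXn /= !derC => /fpsXM_inj.
set A := \prod_(i < n) _; set B := \prod_(i < N + N) _.
have -> : ((1 - 'X) * (A * B))^`().[1] = - (A.[1] * B.[1]).
  rewrite derivM hornerD [((1 - 'X) * _).[1]]hornerM.
  rewrite derivB derivX -polyC1 derivC !hornerE subrr /=.
  by rewrite mul0r addr0 mulN1r mulNr.
have -> : A.[1] = qpoch fpsX n.
  rewrite horner_prod; apply: eq_bigr => i _.
  by rewrite -rmorphXn /= !hornerE mulrN1.
have -> : B.[1] = (-1) ^+ (N + N) * qpoch fpsX (N + N).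
  rewrite horner_prod -[X in _ ^+ X]card_ord -prodr_const -big_split.
  by apply: eq_bigr => i _ /=; rewrite -rmorphXn /= !hornerE; ring.
rewrite raddf_sum horner_sum => E.
apply: (@eqX_trans _ _ (euler int * ((-1) ^+ n *
  \sum_(j < (n + n).+1) fpsX ^+ tri n j * qbin fpsX (n + n) j * ((-1) ^+ (n + n - j) * (n + n -
    j)%:R)))).
  have <- : qpoch fpsX n * qpoch fpsX (N + N) = (-1) ^+ n * \sum_(j < (n + n).+1)
      fpsX ^+ tri n j * qbin fpsX (n + n) j * ((-1) ^+ (n + n - j) * (n + n - j)%:R) :> fps int.
    have -> : \sum_(j < (n + n).+1) fpsX ^+ tri n j * qbin fpsX (n + n) j *
        ((-1) ^+ (n + n - j) * (n + n - j)%:R) =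
        - (qpoch fpsX n * ((-1) ^+ (N + N) * qpoch fpsX (N + N))) :> fps int.
      rewrite E; apply: eq_bigr => j _ /=.
      rewrite -rmorphXn -(qbin_rmorph polyC) -rmorphM /= derC [(- 'X) ^+ _]exprNn; congr (_ * _).
      have -> : (-1) ^+ (n + n - j) = ((-1) ^+ (n + n - j))%:P :> {poly fps int}.
        by rewrite polyC_exp polyCN.
      by rewrite derC derivXn hornerMn hornerXn expr1n.
    by rewrite /n exprS -signr_odd addnn odd_double; ring.
  rewrite !exprS expr0 mulr1; apply: eqXM => //; apply: eqXM; apply/eqX_sym.
    by apply: eqX_leq (leqnSn N) (qpoch_eqX _ _); rewrite /n; lia.
  by apply: eqX_leq (leqnSn N) (qpoch_eqX _ _); lia.
rewrite !mulr_sumr; apply: eqX_sum => j _.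
rewrite !rmorphM !rmorphXn !rmorphN1 rmorph_nat.
rewrite [X in eqX _ _ X]mulrC [X in eqX _ X _](_ : _ =
  euler int * (fpsX ^+ tri n j * qbin fpsX (n + n) j) *
  ((-1) ^+ n * ((-1) ^+ (n + n - j) * (n + n - j)%:R))); last by ring.
apply: eqXM => //; apply: qbin_lim; rewrite /n; first by lia.
by have := ltn_ord j; rewrite /n; lia.
Qed.

Lemma jacobi_support k : (k %% 5 == 2)%N || (k %% 5 == 4)%N -> (euler int ^+ 3) k = 0.
Proof.
move=> k24; rewrite (@jacobi_identity k.+1) //; set n := (k.+1 + k.+1).+1.
exact: (@tri_sum_support n (fun j => (-1) ^+ n * ((-1) ^+ (n + n - j) * (n + n - j)%:R))).
Qed.

(** * The pentagonal number theorem *)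

Section Shanks.
Variables (R : comNzRingType) (q : R).

Let tail s n := \prod_(s <= i < n) (1 - q ^+ i.+1).
Let term n s := (-1) ^+ s * tail s n * q ^+ (s * n + 'C(s.+1, 2)).

(** The differences telescope in [s]; at [t = n] the closed form is one of the two summands that the
    pentagonal sum gains from [n] to [n.+1]. *)
Lemma shanks_step n t : (t <= n)%N ->
  \sum_(s < t.+1) (term n.+1 s - term n s) =
  - ((-1) ^+ t * tail t n * q ^+ (t.+1 * n.+1 + 'C(t.+1, 2))).
Proof.
have tailS s m : (s <= m)%N -> tail s m.+1 = tail s m * (1 - q ^+ m.+1).
  by move=> lesm; rewrite /tail big_nat_recr.
elim: t => [|t IH] letn.
  rewrite big_ord1 /term tailS // !mul0n !add0n mul1n addn0 !expr0.
  by rewrite /= !mul1r !mulr1; ring.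
rewrite big_ord_recr IH ?(ltnW letn) //= /term tailS //.
have -> : tail t n = (1 - q ^+ t.+1) * tail t.+1 n by rewrite /tail big_ltn.
have -> : (t.+1 * n.+1 + 'C(t.+2, 2) = (t.+1 * n.+1 + 'C(t.+1, 2)) + t.+1)%N.
  by rewrite binS bin1; lia.
have -> : (t.+1 * n + 'C(t.+2, 2) = t.+1 * n.+1 + 'C(t.+1, 2))%N.
  by rewrite binS bin1; lia.
have -> : (t.+2 * n.+1 + 'C(t.+2, 2) = (t.+1 * n.+1 + 'C(t.+1, 2)) + t.+1 + n.+1)%N.
  by rewrite binS bin1; lia.
by rewrite !exprD [(-1) ^+ t.+1]exprS; ring.
Qed.

(* Shanks' finite form of the pentagonal number theorem. *)
Lemma shanks n :
  \sum_(s < n.+1) term n s =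
  \sum_(m < n.+1) (-1) ^+ m * q ^+ (m * m + 'C(m.+1, 2)) -
  \sum_(m < n) (-1) ^+ m * q ^+ (m.+1 * m.+1 + 'C(m.+1, 2)).
Proof.
elim: n => [|n IH].
  by rewrite !big_ord1 big_ord0 /term /tail big_geq // !mulr1 subr0.
rewrite big_ord_recr [X in X - _]big_ord_recr [X in _ - X]big_ord_recr /=.
have := shanks_step (leqnn n); rewrite sumrB IH => /eqP; rewrite subr_eq => /eqP ->.
rewrite /term /tail !big_geq // !mulr1; ring.
Qed.

Lemma shanks_head n : term n 0 = qpoch q n.
Proof. by rewrite /term /tail mul1r mulr1 big_mkord. Qed.

End Shanks.

Section Pentagonal.
Variable R : comNzRingType.

(** The exponents are the generalized pentagonal numbers m(3m+1)/2 and (m+1)(3m+2)/2, whose signs in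
    Euler's series are opposite. *)
Definition pent (m : nat) : fps R :=
  (-1) ^+ m * (fpsX ^+ (m * m + 'C(m.+1, 2)) - fpsX ^+ (m.+1 * m.+1 + 'C(m.+1, 2))).

(** In Shanks' identity the terms with [s > 0], as well as the second half of the last [pent], have
    exponents beyond the precision. *)
Lemma pentagonal N : eqX N (euler R) (\sum_(m < N) pent m).
Proof.
case: N => // n; apply: eqX_trans (eqX_sym (qpoch_eqX _ (leqnn n))) _.
rewrite -shanks_head.
apply: (@eqX_trans _ _ (\sum_(s < n.+1) (-1) ^+ s * \prod_(s <= i < n) (1 - fpsX ^+ i.+1) * fpsX
  ^+ (s * n + 'C(s.+1, 2)))).
  rewrite big_ord_recl -[X in eqX _ X _]addr0; apply: eqXD => //.
  apply/eqX_sym/eqX0_sum => i _; apply/eqX0_mull/eqX0_Xn; rewrite lift0.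
  by have := leq_bin2 i.+1; nia.
rewrite shanks -[X in eqX _ X]addr0.
have -> : \sum_(m < n.+1) pent m = (\sum_(m < n.+1) (-1) ^+ m * fpsX ^+ (m * m + 'C(m.+1, 2)) -
  \sum_(m < n) (-1) ^+ m * fpsX ^+ (m.+1 * m.+1 + 'C(m.+1, 2))) -
  (-1) ^+ n * fpsX ^+ (n.+1 * n.+1 + 'C(n.+1, 2)).
  rewrite -addrA -opprD -(big_ord_recr n (fun m : 'I_n.+1 => (-1) ^+ m * fpsX ^+ (m.+1 * m.+1 +
    'C(m.+1, 2)))).
  by rewrite -sumrB; apply: eq_bigr => m _; rewrite -mulrBr.
apply: eqXD => //; apply: eqX_sym; rewrite -mulNr.
by apply/eqX0_mull/eqX0_Xn; nia.
Qed.

Lemma dissect_X d i e : (i < d)%N ->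
  dissect d i (fpsX ^+ e) = if (e %% d == i)%N then fpsX ^+ (e %/ d) else 0 :> fps R.
Proof.
move=> ltid; have dgt0 : (0 < d)%N by lia.
rewrite {1}(divn_eq e d) exprD mulnC exprM -dilX // -rmorphXn /=.
rewrite dissect_dilM // dissect_Xn ?ltn_mod // eq_sym.
by case: eqP; rewrite ?mulr1 ?mulr0.
Qed.

Lemma pent_residue m :
  ((m * m + 'C(m.+1, 2)) %% 5 < 3)%N /\ ((m.+1 * m.+1 + 'C(m.+1, 2)) %% 5 < 3)%N.
Proof.
have := bin2_mul2 m; move: 'C(m.+1, 2) => c.
rewrite (divn_eq m 5); move: (m %/ 5)%N (m %% 5)%N (ltn_pmod m (isT : 0 < 5)%N) => a r.
by case: r => [|[|[|[|[|//]]]]] _ E; split; nia.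
Qed.

Lemma euler_support k : (2 < k %% 5)%N -> euler R k = 0.
Proof.
move=> ltk; rewrite (@pentagonal k.+1) // fps_sumE big1 // => m _.
rewrite /pent mulrBr fpsBE; have [r1 r2] := pent_residue m.
have sgnE (f : fps R) : ((-1) ^+ m * f) k = (-1) ^+ m * f k.
  by rewrite -signr_odd -[in RHS]signr_odd; case: (odd m); rewrite ?mulN1r ?mul1r.
rewrite !sgnE !fpsXnE; case: eqP => [Ek|_]; first by rewrite -Ek in r1; lia.
by case: eqP => [Ek|_]; [rewrite -Ek in r2; lia | rewrite subrr].
Qed.

(** Among the ten exponents of five consecutive [pent], only the second one for [r = 0] and the
    first one for [r = 4] are 1 modulo 5; they reproduce [pent l]. *)
Lemma dissect_pent l : \sum_(r < 5) dissect 5 1 (pent (5 * l + r)) = - dil 5 (pent l).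
Proof.
have c := bin2_mul2 l.
have pentE m : dissect 5 1 (pent m) = (-1) ^+ m *
   (dissect 5 1 (fpsX ^+ (m * m + 'C(m.+1, 2))) - dissect 5 1 (fpsX ^+ (m.+1 * m.+1 + 'C(m.+1,
     2)))).
  rewrite -dissectB /pent -signr_odd.
  by case: (odd m); rewrite ?expr1 ?expr0 ?mulN1r ?mul1r -?raddfN.
have X0 e q r : e = (q * 5 + r)%N -> (r < 5)%N -> r != 1%N ->
    dissect 5 1 (fpsX ^+ e) = 0 :> fps R.
  by move=> -> ltr nr; rewrite dissect_X // modnMDl modn_small // (negbTE nr).
have X1 e q : e = (q * 5 + 1)%N -> dissect 5 1 (fpsX ^+ e) = fpsX ^+ q :> fps R.
  by move=> ->; rewrite dissect_X // modnMDl divnMDl // addn0.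
rewrite (eq_bigr _ (fun (r : 'I_5) _ => pentE (5 * l + r)%N)) !big_ord_recr big_ord0 /= add0r.
have := bin2_mul2 (5 * l + 0); have := bin2_mul2 (5 * l + 1).
have := bin2_mul2 (5 * l + 2); have := bin2_mul2 (5 * l + 3).
have := bin2_mul2 (5 * l + 4) => c4 c3 c2 c1 c0.
(* [L] is five times the first exponent of [pent l]; the quotients by 5 of the ten exponents are
   written in terms of it. *)
set C := 'C(l.+1, 2) in c *; set L := (5 * (l * l) + 5 * C)%N.
rewrite (X0 ((5 * l + 0) * _ + _)%N (L - 2 * l)%N 0%N) //; last by rewrite /L; lia.
rewrite (X1 ((5 * l + 0).+1 * _ + _)%N L); last by rewrite /L; lia.
rewrite (X0 ((5 * l + 1) * _ + _)%N (L + l)%N 2) //; last by rewrite /L; lia.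
rewrite (X0 ((5 * l + 1).+1 * _ + _)%N (L + 3 * l + 1)%N 0%N) //; last by rewrite /L; lia.
rewrite (X0 ((5 * l + 2) * _ + _)%N (L + 4 * l + 1)%N 2) //; last by rewrite /L; lia.
rewrite (X0 ((5 * l + 2).+1 * _ + _)%N (L + 6 * l + 2)%N 2) //; last by rewrite /L; lia.
rewrite (X0 ((5 * l + 3) * _ + _)%N (L + 7 * l + 3)%N 0%N) //; last by rewrite /L; lia.
rewrite (X0 ((5 * l + 3).+1 * _ + _)%N (L + 9 * l + 4)%N 2) //; last by rewrite /L; lia.
rewrite (X1 ((5 * l + 4) * _ + _)%N (5 * (l.+1 * l.+1 + C))%N); last by rewrite /L; lia.
rewrite (X0 ((5 * l + 4).+1 * _ + _)%N (L + 12 * l + 7)%N 0%N) //; last by rewrite /L; lia.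
rewrite rmorphM rmorphB !rmorphXn rmorphN1 /= !dilX // -!exprM.
have -> : (5 * (l * l + C) = L)%N by rewrite /L; lia.
have sg5 r : (-1) ^+ (5 * l + r) = (-1) ^+ l * (-1) ^+ r :> fps R.
  by rewrite exprD exprM (_ : (-1) ^+ 5 = -1 :> fps R) //; ring.
by rewrite !sg5; ring.
Qed.

Lemma dissect1_euler : dissect 5 1 (euler R) = - dil 5 (euler R).
Proof.
apply: eqXP => N.
apply: (@eqX_trans _ _ (dissect 5 1 (\sum_(m < 5 * N) pent m))).
  by apply: eqX_dissect => //; apply: pentagonal.
apply: (@eqX_trans _ _ (- dil 5 (\sum_(l < N) pent l))); last first.
  rewrite -mulN1r -[X in eqX _ _ X]mulN1r; apply: eqXM => //.
  by apply: (eqX_leq (N := 5 * N)); [lia | apply/eqX_dil/eqX_sym/pentagonal].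
suff -> : dissect 5 1 (\sum_(m < 5 * N) pent m) = - dil 5 (\sum_(l < N) pent l) by [].
rewrite !raddf_sum /=.
elim: N => [|N IH]; first by rewrite muln0 !big_ord0.
rewrite [RHS]big_ord_recr -IH -dissect_pent mulnS addnC !addnS addn0 /=.
rewrite !big_ord_recr big_ord0 /= add0r !addrA.
by rewrite addn0 !addnS addn0.
Qed.

End Pentagonal.

(** * The 5-dissection of Euler's product *)

Section Recombine.
Variable R : comNzRingType.

Definition recombine (c0 c1 c2 c3 c4 : fps R) : fps R :=
  dil 5 c0 + fpsX * dil 5 c1 + fpsX ^+ 2 * dil 5 c2 + fpsX ^+ 3 * dil 5 c3 +
  fpsX ^+ 4 * dil 5 c4.

Lemma dissect_recombine c0 c1 c2 c3 c4 i : (i < 5)%N ->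
  dissect 5 i (recombine c0 c1 c2 c3 c4) = nth 0 [:: c0; c1; c2; c3; c4] i.
Proof.
have X j c : (i < 5)%N -> (j < 5)%N -> dissect 5 i (fpsX ^+ j * dil 5 c) = if i == j then c else 0.
  by move=> lti ltj; rewrite mulrC dissect_dilM // dissect_Xn //; case: eqP; rewrite ?mulr1 ?mulr0.
move=> lti; rewrite /recombine -[dil 5 c0]mul1r -(expr0 fpsX) -{2}(expr1 fpsX).
rewrite !raddfD /= !X //.
by case: i lti {X} => [|[|[|[|[|//]]]]] _ /=; rewrite ?addr0 ?add0r.
Qed.

Lemma recombine_dissect f : f = recombine (dissect 5 0 f) (dissect 5 1 f)
  (dissect 5 2 f) (dissect 5 3 f) (dissect 5 4 f).
Proof.
rewrite {1}(fps_dissect f (isT : 0 < 5)%N) !big_ord_recr big_ord0 /= add0r.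
by rewrite expr0 mul1r expr1.
Qed.

End Recombine.

Local Notation eul := (euler int).

Lemma euler_dissect0 : dissect 5 0 eul 0%N = 1.
Proof. by rewrite dissectE muln0 addn0 euler0E. Qed.

Lemma euler_recombine :
  eul = recombine (dissect 5 0 eul) (- dil 5 eul) (dissect 5 2 eul) 0 0.
Proof.
rewrite {1}(recombine_dissect eul) dissect1_euler.
have D i : (2 < i < 5)%N -> dissect 5 i eul = 0.
  move=> /andP[i2 i5]; apply: fpsP => n; rewrite dissectE fps0E.
  by apply: euler_support; rewrite mulnC modnMDl modn_small.
by rewrite (D 3) ?(D 4).
Qed.

Lemma fps_natI m (f g : fps int) : (0 < m)%N -> m%:R * f = m%:R * g -> f = g.
Proof.
move=> mgt0 E; apply: fpsP => n; have := congr1 (fun h : fps int => h n) E.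
by rewrite /= !fps_natME => /mulfI ->; rewrite // pnatr_eq0; lia.
Qed.

(* Jacobi's identity makes the component of degree 2 of the cube vanish. *)
Lemma euler_dissect02 : dissect 5 0 eul * dissect 5 2 eul = - dil 5 eul ^+ 2.
Proof.
set a := dissect 5 0 eul; set b := dissect 5 2 eul; set g := dil 5 eul.
(* The cube of a - q g + q^2 b, sorted by residues; its parts of degree 5 and 6 in the explicit q go
   to the multiple of [dil 5 fpsX]. *)
have E : eul ^+ 3 = recombine (a ^+ 3 - 6%:R * fpsX * (g * b ^+ 2) * 0) (- 3%:R * a ^+ 2 * g)
    (3%:R * a * (a * b + g ^+ 2)) (- 6%:R * a * b * g - g ^+ 3)
    (3%:R * a * b ^+ 2 + 3%:R * g ^+ 2 * b) + dil 5 fpsX * recombine (- 3%:R * g * b ^+ 2) (b ^+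
      3) 0 0 0.
  rewrite {1}euler_recombine -/a -/b -/g /recombine !(rmorphXn, rmorphD, rmorphN, rmorphM,
    rmorph_nat, rmorph0) /= dilX //.
  ring.
have : dissect 5 2 (eul ^+ 3) = 0.
  apply: fpsP => n; rewrite dissectE fps0E jacobi_support //.
  by rewrite mulnC modnMDl.
rewrite E raddfD /= dissect_dilM // !dissect_recombine //= mulr0 addr0 -mulrA.
rewrite -[RHS](mulr0 3%:R) => /(@fps_natI 3 _ _ isT) E2.
have /(fps_mulfI euler_dissect0) E3 : a * (a * b + g ^+ 2) = a * 0 by rewrite E2 mulr0.
by apply/eqP; rewrite -subr_eq0 opprK E3.
Qed.

(* Locked, since rewriting with [rmorphM] unfolds products hidden in definitions. *)
Definition rho : fps int := locked (dil 5 eul * fps_inv (dissect 5 0 eul)).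
Definition rho2 : fps int := locked (dil 2 rho).
Definition uu : fps int := locked (fpsX * dil 5 rho).
Definition vv : fps int := locked (fpsX ^+ 2 * dil 5 rho2).

Lemma rhoE : rho = dil 5 eul * fps_inv (dissect 5 0 eul).
Proof. by rewrite /rho -lock. Qed.

Lemma rho2E : rho2 = dil 2 rho.
Proof. by rewrite /rho2 -lock. Qed.

Lemma uuE : uu = fpsX * dil 5 rho.
Proof. by rewrite /uu -lock. Qed.

Lemma vvE : vv = fpsX ^+ 2 * dil 5 rho2.
Proof. by rewrite /vv -lock. Qed.

Lemma rho0E : rho 0%N = 1.
Proof. by rewrite rhoE fpsM0E dil0E euler0E fps_inv0 ?euler_dissect0. Qed.

(** The classical f_1 / (q f_25) = 1/u - 1 - u without denominators: the three components of [eul]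
    are f_5 / rho, - f_5 and - rho f_5, the last by [euler_dissect02]. *)
Lemma euler_uu : dil 5 rho * eul = dil 25 eul * (1 - uu - uu ^+ 2).
Proof.
have E0 : rho * dissect 5 0 eul = dil 5 eul.
  by rewrite rhoE -mulrA [_ * dissect _ _ _]mulrC fps_mulfV ?mulr1 ?euler_dissect0.
have E2 : rho * dissect 5 2 eul = - rho ^+ 2 * dil 5 eul.
  apply: (fps_mulfI euler_dissect0); rewrite mulrCA euler_dissect02 -E0; ring.
rewrite {1}euler_recombine /recombine uuE.
rewrite !mulrDr ![dil 5 rho * (fpsX * _)]mulrCA ![dil 5 rho * (fpsX ^+ _ * _)]mulrCA.
rewrite -!rmorphM /= E0 E2 -(@dil_dil _ 5 5) //.
by rewrite !(rmorphXn, rmorphM, rmorphN, rmorph0) /=; ring.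
Qed.

Lemma dil2_uu : dil 2 uu = vv.
Proof. by rewrite uuE vvE rho2E rmorphM /= dilX // !dil_dil. Qed.

Lemma euler_vv : dil 5 rho2 * dil 2 eul = dil 50 eul * (1 - vv - vv ^+ 2).
Proof.
have := congr1 (dil 2) euler_uu.
by rewrite [LHS]rmorphM [RHS]rmorphM !rmorphB rmorph1 rmorphXn /= dil2_uu rho2E !dil_dil.
Qed.

(** Multiplying Gauss' series f_2^2 / f_1 by f_1 gives f_2^2, and both factors have known
    dissections. Since Gauss' series has only three nonzero components, these can be eliminated from
    four component equations, which leaves a relation between [rho] and [rho2]. *)
Lemma rho_rho2 : rho2 - rho ^+ 2 = fpsX * rho * rho2 ^+ 2 * (rho2 + rho ^+ 2).
Proof.
pose Psi := dil 2 eul ^+ 2 * fps_inv eul.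
have PsiE : eul * Psi = dil 2 eul ^+ 2.
  by rewrite /Psi mulrC -mulrA [_ * eul]mulrC fps_mulfV ?mulr1 ?euler0E.
pose g := dil 5 eul; pose c := rho * dil 10 eul ^+ 2; pose W := dil 5 (g * rho2 ^+ 2) * Psi.
have W24 i : (i == 2) || (i == 4) -> dissect 5 i W = 0.
  move=> i24; rewrite /W dissect_dilM; last by case/orP: i24 => /eqP ->.
  have -> : dissect 5 i Psi = 0; last by rewrite mulr0.
  apply: fpsP => n; rewrite dissectE psi_support // mulnC modnMDl.
  by case/orP: i24 => /eqP ->.
have E : (1 - uu - uu ^+ 2) * W = dil 5 c * (1 - vv - vv ^+ 2) ^+ 2.
  rewrite /W /c /g !(rmorphXn, rmorphM) /= (@dil_dil _ 5 5) // (@dil_dil _ 5 10) // -![dil (5 *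
    5)%N _]/(dil 25 _) -![dil (5 * 10)%N _]/(dil 50 _).
  have -> : (1 - uu - uu ^+ 2) * (dil 25 eul * dil 5 rho2 ^+ 2 * Psi) =
     (dil 25 eul * (1 - uu - uu ^+ 2)) * (dil 5 rho2 ^+ 2 * Psi) by ring.
  rewrite -euler_uu [RHS](_ : _ = dil 5 rho * (dil 50 eul * (1 - vv - vv ^+ 2)) ^+ 2); last by ring.
  by rewrite -euler_vv exprMn -PsiE; ring.
move: E; rewrite (recombine_dissect W) (W24 2) // (W24 4) //.
set W0 := dissect 5 0 W; set W1 := dissect 5 1 W; set W3 := dissect 5 3 W.
have -> : (1 - uu - uu ^+ 2) * recombine W0 W1 0 W3 0 =
    recombine (W0 - fpsX * rho ^+ 2 * W3) (W1 - rho * W0) (- rho * W1 - rho ^+ 2 * W0)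
       (W3 - rho ^+ 2 * W1) (- rho * W3).
  by rewrite /recombine uuE !(rmorphXn, rmorphB, rmorphM, rmorphN, rmorph0) /= dilX //; ring.
have -> : dil 5 c * (1 - vv - vv ^+ 2) ^+ 2 =
    recombine c (2%:R * fpsX * c * rho2 ^+ 3) (- 2%:R * c * rho2) (fpsX * c * rho2 ^+ 4) (- c *
      rho2 ^+ 2).
  by rewrite /recombine vvE !(rmorphXn, rmorphB, rmorphM, rmorphN, rmorph_nat) /= dilX //; ring.
move=> E; have Ei i (lti : (i < 5)%N) := congr1 (dissect 5 i) E.
have := Ei 1%N isT; have := Ei 2%N isT; have := Ei 3%N isT; have := Ei 4%N isT.
rewrite !dissect_recombine //= => E4 E3 E2 E1.
have c0 : (c * rho2) 0%N = 1.
  by rewrite /c expr2 !fpsM0E rho2E !dil0E rho0E euler0E.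
apply/(fps_mulfI c0)/(@fps_natI 2) => //.
(* Eliminate [W0], [W1] and [W3] from the components 1 to 4. *)
have -> : 2%:R * (c * rho2 * (rho2 - rho ^+ 2)) = - 2%:R * (- c * rho2 ^+ 2) - 2%:R * c * rho2 *
  rho ^+ 2 by ring.
rewrite -E4.
have -> : W3 = fpsX * c * rho2 ^+ 4 + rho ^+ 2 * W1 by rewrite -E3; ring.
have E12 : 2%:R * (rho * W1) = 2%:R * (fpsX * rho * c * rho2 ^+ 3 + c * rho2).
  have -> : 2%:R * (rho * W1) = rho * (W1 - rho * W0) - (- rho * W1 - rho ^+ 2 * W0) by ring.
  by rewrite E1 E2; ring.
have -> : - 2%:R * (- rho * (fpsX * c * rho2 ^+ 4 + rho ^+ 2 * W1)) - 2%:R * c * rho2 * rho ^+ 2 =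
   2%:R * rho * fpsX * c * rho2 ^+ 4 + rho ^+ 2 * (2%:R * (rho * W1)) - 2%:R * c * rho2 * rho ^+ 2
     by ring.
by rewrite E12; ring.
Qed.

(** The relation v - u^2 = u v^2 (v + u^2), solved for a monomial so that [ring] can reduce modulo
    it. *)
Lemma uu_vv : uu ^+ 3 * vv ^+ 2 = vv - uu ^+ 2 - uu * vv ^+ 3.
Proof.
have := congr1 (dil 5) rho_rho2.
rewrite !(rmorphXn, rmorphB, rmorphD, rmorphM) /= dilX // uuE vvE => E.
have -> : fpsX ^+ 2 * dil 5 rho2 - (fpsX * dil 5 rho) ^+ 2 =
  fpsX ^+ 2 * (dil 5 rho2 - dil 5 rho ^+ 2) by ring.
by rewrite E; ring.
Qed.

(** * Norms over the fifth roots of unity *)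

Section Map.
Variables (R S : comNzRingType) (phi : {rmorphism R -> S}).

Definition fps_map (f : fps R) : fps S := Fps (fun n => phi (f n)).

Lemma fps_mapE f n : fps_map f n = phi (f n). Proof. by []. Qed.

Lemma fps_mapB : {morph fps_map : f g / f - g}.
Proof. by move=> f g; apply: fpsP => n; rewrite fpsBE !fps_mapE rmorphB. Qed.

Lemma fps_map1 : fps_map 1 = 1.
Proof. by apply: fpsP => n; rewrite fps_mapE !fps1E rmorph_nat. Qed.

Lemma fps_mapM : {morph fps_map : f g / f * g}.
Proof.
move=> f g; apply: fpsP => n; rewrite fps_mapE !fpsME rmorph_sum.
by apply: eq_bigr => i _; rewrite rmorphM.
Qed.

HB.instance Definition _ := GRing.isZmodMorphism.Build _ _ fps_map fps_mapB.
HB.instance Definition _ :=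
  GRing.isMonoidMorphism.Build _ _ fps_map (conj fps_map1 fps_mapM).

Lemma fps_mapX : fps_map fpsX = fpsX.
Proof. by apply: fpsP => n; rewrite fps_mapE !coefsE rmorph_nat. Qed.

Lemma fps_map_dil d f : fps_map (dil d f) = dil d (fps_map f).
Proof.
by apply: fpsP => n; rewrite fps_mapE !dilE fps_mapE; case: ifP; rewrite ?rmorph0.
Qed.

Lemma qpoch_rmorph (q : R) n : phi (qpoch q n) = qpoch (phi q) n.
Proof.
rewrite rmorph_prod; apply: eq_bigr => i _.
by rewrite rmorphB rmorph1 rmorphXn.
Qed.

End Map.

Lemma fps_map_euler (R S : comNzRingType) (phi : {rmorphism R -> S}) :
  fps_map phi (euler R) = euler S.
Proof.
apply: fpsP => n; rewrite fps_mapE !coefsE -fps_mapE.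
by rewrite (qpoch_rmorph (fps_map phi)) /= fps_mapX.
Qed.

Section Twist.
Variables (R : comNzRingType) (w : R).

Definition twist (f : fps R) : fps R := Fps (fun n => w ^+ n * f n).

Lemma twistE f n : twist f n = w ^+ n * f n. Proof. by []. Qed.

Lemma twistB : {morph twist : f g / f - g}.
Proof. by move=> f g; apply: fpsP => n; rewrite fpsBE !twistE fpsBE mulrBr. Qed.

Lemma twist1 : twist 1 = 1.
Proof.
by apply: fpsP => n; rewrite twistE !fps1E; case: n => [|n]; rewrite ?mulr0 ?mul1r.
Qed.

Lemma twistM : {morph twist : f g / f * g}.
Proof.
move=> f g; apply: fpsP => n; rewrite twistE !fpsME mulr_sumr.
apply: eq_bigr => i _; rewrite !twistE mulrACA -exprD subnKC //.
by rewrite -ltnS.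
Qed.

HB.instance Definition _ := GRing.isZmodMorphism.Build _ _ twist twistB.
HB.instance Definition _ := GRing.isMonoidMorphism.Build _ _ twist (conj twist1 twistM).

Lemma twistX : twist fpsX = fpsC w * fpsX.
Proof.
apply: fpsP => n; rewrite twistE fpsCME coefsE.
by case: eqP => [->|]; rewrite ?expr1 ?mulr0.
Qed.

Lemma twist_dil d f : w ^+ d = 1 -> twist (dil d f) = dil d f.
Proof.
move=> w1; apply: fpsP => n; rewrite twistE !dilE.
case: ifP => [/dvdnP[k ->]|]; last by rewrite mulr0.
by rewrite mulnC exprM w1 expr1n mul1r.
Qed.

Lemma eqX_twist N f g : eqX N f g -> eqX N (twist f) (twist g).
Proof. by move=> E n ltnN; rewrite !twistE E. Qed.

End Twist.

Section Norm.
Variables (R : idomainType) (z : R).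
Hypothesis z5 : 5.-primitive_root z.

Definition fps_norm (f : fps R) : fps R := \prod_(i < 5) twist (z ^+ i) f.

Lemma fps_normM f g : fps_norm (f * g) = fps_norm f * fps_norm g.
Proof. by rewrite /fps_norm -big_split; apply: eq_bigr => i _; rewrite rmorphM. Qed.

Lemma fps_norm_dil f : fps_norm (dil 5 f) = dil 5 f ^+ 5.
Proof.
rewrite -[X in _ ^+ X]card_ord -prodr_const; apply: eq_bigr => i _.
by rewrite twist_dil // -exprM mulnC exprM (prim_expr_order z5) expr1n.
Qed.

Lemma root5_sum (w : R) : w ^+ 5 = 1 -> w != 1 -> w ^+ 4 = - 1 - w - w ^+ 2 - w ^+ 3.
Proof.
move=> w5 wn1; apply/eqP; rewrite -subr_eq0 -(mulrI_eq0 _ (@mulfI R (w - 1) _)) ?subr_eq0 //.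
apply/eqP; transitivity (w ^+ 5 - 1); last by rewrite w5 subrr.
by ring.
Qed.

(** Writing 1 - u - u^2 = (1 - a u)(1 - b u), the norm is (1 - a^5 u^5)(1 - b^5 u^5), where a^5 +
    b^5 = 11 is a Lucas number. The product is expanded directly, modulo the cyclotomic relation. *)
Lemma fps_norm_golden (u : fps R) : (forall i, twist (z ^+ i) u = fpsC z ^+ i * u) ->
  fps_norm (1 - u - u ^+ 2) = 1 - 11%:R * u ^+ 5 - u ^+ 10.
Proof.
move=> tw; have zE : fpsC z ^+ 4 = - 1 - fpsC z - fpsC z ^+ 2 - fpsC z ^+ 3.
  rewrite -!rmorphXn /= root5_sum ?(prim_expr_order z5) //.
    by rewrite !rmorphB rmorphN1.
  by rewrite -[z]expr1 -(prim_order_dvd z5).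
rewrite /fps_norm !big_ord_recl big_ord0 /= !rmorphB !rmorph1 !rmorphXn /= !tw.
rewrite /bump /=; ring: zE.
Qed.

Lemma fps_norm_1BXn n : fps_norm (1 - fpsX ^+ n.+1) =
  if (5 %| n.+1)%N then (1 - fpsX ^+ n.+1) ^+ 5 else 1 - fpsX ^+ (5 * n.+1).
Proof.
have twE i : twist (z ^+ i) (1 - fpsX ^+ n.+1) = 1 - fpsC (z ^+ n.+1) ^+ i * fpsX ^+ n.+1.
  rewrite rmorphB rmorph1 rmorphXn /= twistX exprMn -!rmorphXn /=.
  by rewrite -!exprM mulnC.
rewrite /fps_norm (eq_bigr _ (fun (i : 'I_5) _ => twE i)).
set w := fpsC (z ^+ n.+1); case: ifPn => dvd5.
  have -> : w = 1 by rewrite /w; move: dvd5; rewrite (prim_order_dvd z5) => /eqP ->.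
  by rewrite !big_ord_recl big_ord0 /= !expr1n; ring.
have wE : w ^+ 4 = - 1 - w - w ^+ 2 - w ^+ 3.
  rewrite /w -!rmorphXn /= root5_sum -?exprM 1?mulnC ?exprM ?(prim_expr_order z5) ?expr1n //.
    by rewrite !rmorphB rmorphN1.
  by rewrite -(prim_order_dvd z5).
rewrite mulnC [X in _ = _ - X]exprM; move: (fpsX ^+ n.+1) => y.
rewrite !big_ord_recl big_ord0 /= /bump /=; ring: wE.
Qed.

(** Factors of index prime to 5 have norm 1 - q^(5m); those of index divisible by 5 are raised to
    the fifth power. The factor in q^25 completes the former to a partial product of f_5. *)
Lemma fps_norm_qpoch n : fps_norm (qpoch fpsX (5 * n)) * dil 25 (qpoch fpsX n) =
  dil 5 (qpoch fpsX (5 * n)) * dil 5 (qpoch fpsX n) ^+ 5.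
Proof.
have norm1 : fps_norm 1 = 1.
  by rewrite /fps_norm big1 // => i _; rewrite rmorph1.
elim: n => [|n IH]; first by rewrite /qpoch !big_ord0 norm1 !rmorph1 expr1n.
have qS m : qpoch fpsX m.+1 = qpoch fpsX m * (1 - fpsX ^+ m.+1) :> fps R.
  by rewrite /qpoch big_ord_recr.
rewrite (_ : (5 * n.+1 = (5 * n).+4.+1)%N); last lia.
rewrite !qS !fps_normM !fps_norm_1BXn.
have dv r : (r < 5)%N -> (5 %| (5 * n + r))%N = (r == 0%N).
  by move=> ltr; rewrite dvdn_addr ?dvdn_mulr //; case: r ltr => [|[|[|[|[|]]]]].
rewrite (_ : (5 * n).+4.+1 = (5 * n + 5)%N); last lia.
rewrite -[(5 * n).+4](addn4 (5 * n)) -[(5 * n).+3](addn3 (5 * n)) -[(5 * n).+2](addn2 (5 * n))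
  -[(5 * n).+1](addn1 (5 * n)).
rewrite (_ : (5 * n + 5 = 5 * n.+1)%N); last lia.
rewrite (dv 1%N) // (dv 2%N) // (dv 3%N) // (dv 4%N) //=.
rewrite dvdn_mulr // !(rmorphXn, rmorphM) /= !rmorphB !rmorph1 !rmorphXn /= !dilX // -!exprM.
have -> : (5 * (5 * n.+1) = 25 * n.+1)%N by lia.
move: IH; set A := fps_norm _; set B := dil 25 _; set C := dil 5 _; set D := dil 5 _ => IH.
transitivity (A * B * ((1 - fpsX ^+ (5 * (5 * n + 1))) * (1 - fpsX ^+ (5 * (5 * n + 2))) *
  (1 - fpsX ^+ (5 * (5 * n + 3))) * (1 - fpsX ^+ (5 * (5 * n + 4))) *
  (1 - fpsX ^+ (5 * n.+1)) ^+ 5 * (1 - fpsX ^+ (25 * n.+1)))); first by ring.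
rewrite IH; ring.
Qed.

Lemma fps_norm_euler : fps_norm (euler R) * dil 25 (euler R) = dil 5 (euler R) ^+ 6.
Proof.
apply: eqXP => N; have lim k : (N <= k)%N -> eqX N (qpoch fpsX k) (euler R).
  by move=> leNk; apply: eqX_leq (leqnSn N) (qpoch_eqX _ leNk).
have limd d k : (0 < d)%N -> (N <= k)%N -> eqX N (dil d (qpoch fpsX k)) (dil d (euler R)).
  by move=> d0 leNk; apply: (eqX_leq (N := d * N)); [nia | apply: eqX_dil; apply: lim].
apply: (@eqX_trans _ _ (fps_norm (qpoch fpsX (5 * N)) * dil 25 (qpoch fpsX N))).
  apply: eqXM; last by apply/eqX_sym/limd.
  by apply: eqX_prod => i _; apply/eqX_twist/eqX_sym/lim; lia.
rewrite fps_norm_qpoch [X in eqX _ _ X]exprS; apply: eqXM; first by apply: limd; lia.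
by apply: eqX_exp; apply: limd.
Qed.

End Norm.

(** * The Hauptmodul *)

Lemma fps_map_inj (R S : comNzRingType) (phi : {rmorphism R -> S}) :
  injective phi -> injective (fps_map phi).
Proof.
move=> inj f g E; apply: fpsP => n; apply: inj.
exact: (congr1 (fun h : fps S => h n) E).
Qed.

(** The norm of [euler_uu], with q^5 replaced by q. It is taken over [algC], which has a primitive
    fifth root of unity, and brought back by injectivity. *)
Lemma rho_euler6 :
  rho ^+ 5 * eul ^+ 6 =
  dil 5 eul ^+ 6 * (1 - 11%:R * (fpsX * rho ^+ 5) - (fpsX * rho ^+ 5) ^+ 2).
Proof.
have [z z5] := C_prim_root_exists (isT : (0 < 5)%N).
pose phi := (intmul (1 : algC) : {rmorphism int -> algC}).
apply: (@fps_map_inj _ _ phi); first exact: intr_inj.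
apply: (@dilK _ 5) => //.
set r := fps_map phi rho; set e := euler algC.
have euE : dil 5 r * e = dil 5 (dil 5 e) * (1 - fpsX * dil 5 r - (fpsX * dil 5 r) ^+ 2).
  have := congr1 (fps_map phi) euler_uu; rewrite uuE [LHS]rmorphM [RHS]rmorphM /=.
  rewrite !rmorphB rmorph1 rmorphXn !rmorphM /= !fps_map_dil fps_map_euler fps_mapX -/r -/e.
  by rewrite dil_dil.
have tw i : twist (z ^+ i) (fpsX * dil 5 r) = fpsC z ^+ i * (fpsX * dil 5 r).
  rewrite rmorphM /= twistX twist_dil ?rmorphXn ?mulrA //.
  by rewrite -exprM mulnC exprM (prim_expr_order z5) expr1n.
have := congr1 (fps_norm z) euE.
rewrite !fps_normM !fps_norm_dil // fps_norm_golden // => Nu.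
rewrite !(rmorphXn, rmorphB, rmorph1, rmorph_nat, rmorphM) /= !fps_map_dil fps_map_euler fps_mapX
  -/r -/e.
rewrite dilX //.
rewrite -(fps_norm_euler z5) -/e [LHS]mulrA Nu dil_dil // -[(5 * 5)%N]/25%N.
by move: (dil 5 r) (dil _ e) => a b; ring.
Qed.

(** Ramanujan's parameter k = R(q) R(q^2)^2, where R(q) = q^(1/5) [rho] is the Rogers-Ramanujan
    continued fraction. *)
Definition kk : fps int := locked (fpsX * rho * rho2 ^+ 2).
Lemma kkE : kk = fpsX * rho * rho2 ^+ 2.
Proof. by rewrite /kk -lock. Qed.
Definition PP : fps int := 1 + kk - kk ^+ 2.
Definition QQ : fps int := 1 - 4%:R * kk - kk ^+ 2.

Lemma kk0E : kk 0%N = 0. Proof. by rewrite kkE -mulrA fpsXME. Qed.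

Lemma PP0E : PP 0%N = 1.
Proof. by rewrite /PP fpsBE fpsDE fps1E fpsX0E kk0E. Qed.

Lemma rho2_kk : (1 - kk) * rho2 = (1 + kk) * rho ^+ 2.
Proof.
apply/eqP; rewrite -subr_eq0; apply/eqP; rewrite kkE.
transitivity (rho2 - rho ^+ 2 - fpsX * rho * rho2 ^+ 2 * (rho2 + rho ^+ 2)); first by ring.
by rewrite rho_rho2 subrr.
Qed.

Lemma fps_lreg (R : idomainType) (f g : fps R) : f 0%N != 0 -> f * g = 0 -> g = 0.
Proof.
move=> f0 fg0; apply: fpsP; elim/ltn_ind => n IH.
have := congr1 (fun h : fps R => h n) fg0; rewrite /= fpsME big_ord_recl subn0.
rewrite big1 ?addr0 => [/eqP|i _]; last first.
  by rewrite IH ?mulr0 //= /bump /=; have := ltn_ord i; lia.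
by rewrite mulf_eq0 (negbTE f0) => /eqP.
Qed.

Lemma fps_cube_inj (a b : fps int) : a 0%N = 1 -> b 0%N = 1 -> a ^+ 3 = b ^+ 3 -> a = b.
Proof.
move=> a0 b0 ab; apply/eqP; rewrite -subr_eq0; apply/eqP.
apply: (@fps_lreg _ (a ^+ 2 + a * b + b ^+ 2)).
  by rewrite !fpsDE !fpsX0E fpsM0E a0 b0.
by transitivity (a ^+ 3 - b ^+ 3); [ring | rewrite ab subrr].
Qed.

Definition ss : fps int := locked (kk * fps_inv PP).
Lemma ssE : ss = kk * fps_inv PP. Proof. by rewrite /ss -lock. Qed.

Lemma ss_PP : ss * PP = kk.
Proof. by rewrite ssE -mulrA [_ * PP]mulrC fps_mulfV ?mulr1 ?PP0E. Qed.

(* Both sides have the same cube, by the norms of the dissections of the Euler products. *)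
Lemma ss_eta : ss * (dil 2 eul ^+ 4 * dil 5 eul ^+ 2) = fpsX * (dil 10 eul ^+ 4 * eul ^+ 2).
Proof.
pose a := rho * rho2 ^+ 2 * fps_inv PP * (dil 2 eul ^+ 4 * dil 5 eul ^+ 2).
pose b := dil 10 eul ^+ 4 * eul ^+ 2.
have PV : PP * fps_inv PP = 1 by rewrite fps_mulfV ?PP0E.
have a0 : a 0%N = 1.
  by rewrite /a !expr2 !exprS !expr0 !fpsM0E fps_inv0 ?PP0E // rho2E !dil0E rho0E euler0E.
have b0 : b 0%N = 1 by rewrite /b !exprS !expr0 !fpsM0E dil0E euler0E.
suff ab : a ^+ 3 = b ^+ 3.
  have E : a = b by apply: fps_cube_inj.
  by rewrite -/b -E /a ssE kkE; ring.
have R1 := rho_euler6; have R2 := congr1 (dil 2) rho_euler6.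
rewrite !(rmorphXn, rmorphB, rmorph1, rmorph_nat, rmorphM) /= in R2.
rewrite dil_dil // dilX // -rho2E -[(2 * 5)%N]/10%N in R2.
move: R1 R2; rewrite /b; set f5 := dil 5 eul; set f10 := dil 10 eul; set f2 := dil 2 eul.
set N := (X in _ = _ * X) => R1; set N' := (X in _ = _ * X) => R2.
have w := rho2_kk.
(* Ramanujan's R(q)^5 = k ((1 - k) / (1 + k))^2 and, next, R(q^2)^5 = k^2 (1 + k) / (1 - k). *)
have kx : fpsX * rho ^+ 5 * (1 + kk) ^+ 2 = kk * (1 - kk) ^+ 2.
  transitivity (fpsX * rho * ((1 + kk) * rho ^+ 2) ^+ 2); first by ring.
  by rewrite -w [X in _ = X * _]kkE; ring.
have kx2 : fpsX ^+ 2 * rho2 ^+ 5 * (1 - kk) = kk ^+ 2 * (1 + kk).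
  transitivity (fpsX ^+ 2 * rho2 ^+ 4 * ((1 - kk) * rho2)); first by ring.
  by rewrite w [X in _ = X ^+ 2 * _]kkE; ring.
have NE : (1 + kk) ^+ 4 * N = PP * QQ ^+ 2.
  transitivity ((1 + kk) ^+ 4 - 11%:R * (1 + kk) ^+ 2 * (fpsX * rho ^+ 5 * (1 + kk) ^+ 2) -
    (fpsX * rho ^+ 5 * (1 + kk) ^+ 2) ^+ 2); first by rewrite /N; ring.
  by rewrite kx /PP /QQ; ring.
have NE' : (1 - kk) ^+ 2 * N' = QQ * PP ^+ 2.
  transitivity ((1 - kk) ^+ 2 - 11%:R * (1 - kk) * (fpsX ^+ 2 * rho2 ^+ 5 * (1 - kk)) -
    (fpsX ^+ 2 * rho2 ^+ 5 * (1 - kk)) ^+ 2); first by rewrite /N'; ring.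
  by rewrite kx2 /PP /QQ; ring.
(* Comparing [NE] with the square of [NE'] removes [QQ]. *)
have NN : rho ^+ 8 * N' ^+ 2 = PP ^+ 3 * rho2 ^+ 4 * N.
  have u0 : ((1 + kk) ^+ 4 * (1 - kk) ^+ 4) 0%N = 1.
    by rewrite fpsM0E !fpsX0E fpsDE fpsBE kk0E.
  apply: (fps_mulfI u0).
  transitivity (((1 + kk) * rho ^+ 2) ^+ 4 * ((1 - kk) ^+ 2 * N') ^+ 2); first by ring.
  transitivity (PP ^+ 3 * ((1 - kk) * rho2) ^+ 4 * ((1 + kk) ^+ 4 * N)); last by ring.
  by rewrite NE NE' w; ring.
have r0 : (rho ^+ 5 * rho2 ^+ 4 * PP ^+ 3) 0%N = 1.
  by rewrite !(fpsX0E, fpsM0E) PP0E rho2E dil0E rho0E !expr1n.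
apply: (fps_mulfI r0); rewrite /a -/f2 -/f5.
transitivity ((PP * fps_inv PP) ^+ 3 * rho ^+ 8 * (rho2 ^+ 5 * f2 ^+ 6) ^+ 2 * f5 ^+ 6); first by
  ring.
rewrite PV R2.
transitivity (rho ^+ 8 * N' ^+ 2 * f10 ^+ 12 * f5 ^+ 6); first by ring.
rewrite NN.
transitivity (PP ^+ 3 * rho2 ^+ 4 * f10 ^+ 12 * (rho ^+ 5 * eul ^+ 6)); last by ring.
by rewrite R1; ring.
Qed.

(** * Modular equations *)

(* With [zz = m / d] and [s = k / P], these are the modular equation of [zz] over [Z[s]], the
   expansion of the kernel [AA] in powers of [zz], whose coefficients solve the linear system of
   its traces against these powers, and the 5-dissection of [zz]. *)
Section Identities.
Variables (R : comNzRingType) (u v : R).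
Let k := u * v ^+ 2.
Let P := 1 + k - k ^+ 2.
Let Q := 1 - 4%:R * k - k ^+ 2.
Let al := 1 - u - u ^+ 2.
Let be := 1 - v - v ^+ 2.
Let m := v ^+ 2 * al.
Let d := u * be ^+ 2.
Hypothesis uv : u ^+ 3 * v ^+ 2 = v - u ^+ 2 - u * v ^+ 3.

Lemma charpoly_uv : P ^+ 3 * m ^+ 5 =
  (5%:R * k * P ^+ 2 - 25%:R * k ^+ 2 * P + 25%:R * k ^+ 3) * d * m ^+ 4 -
  (- 15%:R * k ^+ 2 * P + 25%:R * k ^+ 3) * d ^+ 2 * m ^+ 3 +
  (- 5%:R * k ^+ 2 * P + 15%:R * k ^+ 3) * d ^+ 3 * m ^+ 2 -
  5%:R * k ^+ 3 * d ^+ 4 * m + k ^+ 3 * d ^+ 5.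
Proof. by rewrite /m /d /al /be /P /k; ring: uv. Qed.

Lemma kernel_uv : k ^+ 2 * Q ^+ 4 * u ^+ 4 * be ^+ 6 = al *
  ((k ^+ 2 * P ^+ 3 + 65%:R * k ^+ 3 * P ^+ 2 + 75%:R * k ^+ 4 * P - 125%:R * k ^+ 5) * d ^+ 4 +
   (26%:R * k ^+ 2 * P ^+ 3 - 40%:R * k ^+ 3 * P ^+ 2 - 550%:R * k ^+ 4 * P + 500%:R * k ^+ 5) *
     m * d ^+ 3 +
   (k * P ^+ 4 - 155%:R * k ^+ 2 * P ^+ 3 - 375%:R * k ^+ 3 * P ^+ 2 + 1875%:R * k ^+ 4 * P -
     1250%:R * k ^+ 5) * m ^+ 2 * d ^+ 2 +
   (- 14%:R * k * P ^+ 4 - 150%:R * k ^+ 2 * P ^+ 3 + 1600%:R * k ^+ 3 * P ^+ 2 -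
     2750%:R * k ^+ 4 * P + 1250%:R * k ^+ 5) * m ^+ 3 * d +
   (6%:R * P ^+ 5 + 60%:R * k * P ^+ 4 - 50%:R * k ^+ 2 * P ^+ 3) * m ^+ 4).
Proof. by rewrite /m /d /al /be /P /Q /k; ring: uv. Qed.

Lemma components_uv : m * P ^+ 3 = d *
  (k * (1 - 3%:R * k - k ^+ 2 + 3%:R * k ^+ 3 + k ^+ 4) +
   (1 + k) * (k * (- 2%:R + 2%:R * k + k ^+ 2 + k ^+ 3) * u +
              k * (3%:R + 2%:R * k + k ^+ 2 + k ^+ 3) * u ^+ 2 +
              (1 - k + 2%:R * k ^+ 2 - 3%:R * k ^+ 3) * u * v +
              (- 1 + k - 2%:R * k ^+ 2 - 2%:R * k ^+ 3) * u ^+ 2 * v)).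
Proof. by rewrite /m /d /al /be /P /k; ring: uv. Qed.

End Identities.

(* The power of 5 in a coefficient is kept apart, as its size is what matters below. *)
Definition mono (R : comNzRingType) (x : R) (u v l : nat) : R :=
  locked (u%:R * 5%:R ^+ v * x ^+ l).

Lemma monoE (R : comNzRingType) (x : R) u v l : mono x u v l = u%:R * 5%:R ^+ v * x ^+ l.
Proof. by rewrite /mono -lock. Qed.

(** A fifth of the power sums of the roots of the equation of degree 5 for [zz], as Newton's
    formulas give them; the last branch is meant for [n = 4]. *)
Definition trace_poly (R : comNzRingType) (x : R) (n : nat) : R :=
  match n with
  | 0 => 1
  | 1 => mono x 1 0 1 - mono x 1 1 2 + mono x 1 1 3
  | 2 => mono x 11 0 2 - mono x 12 1 3 + mono x 7 2 4 - mono x 2 3 5 + mono x 1 3 6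
  | 3 => - mono x 3 0 2 + mono x 79 0 3 - mono x 27 2 4 + mono x 114 2 5 - mono x 58 3 6 + mono x
    18 4 7 - mono x 3 5 8 + mono x 1 5 9
  | _ => - mono x 24 0 3 + mono x 27 2 4 - mono x 268 2 5 + mono x 1492 2 6 - mono x 212 4 7 +
    mono x 507 4 8 - mono x 164 5 9 + mono x 34 6 10 - mono x 4 7 11 + mono x 1 7 12
  end.

Section Traces.
Variables (R : comNzRingType) (x k p r e s : R).
Let P := 1 + k - k ^+ 2.
Hypothesis pp : p ^+ 2 = r - k ^+ 2 * r.
Hypothesis xpr : x * p * r ^+ 2 = k + k ^+ 2.
Hypothesis xr : x ^+ 2 * r ^+ 5 = e.
Hypothesis ek : e * k = e - k ^+ 2 - k ^+ 3.
Hypothesis sP : s * P = k.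
Let c0 := k * (1 - 3%:R * k - k ^+ 2 + 3%:R * k ^+ 3 + k ^+ 4).
Let c1 := k * (- 2%:R + 2%:R * k + k ^+ 2 + k ^+ 3) * p.
Let c2 := (1 - k) * (k * (3%:R + 2%:R * k + k ^+ 2 + k ^+ 3)) * r.
Let c3 := (1 - k + 2%:R * k ^+ 2 - 3%:R * k ^+ 3) * p * r.
Let c4 := (1 - k) * (- 1 + k - 2%:R * k ^+ 2 - 2%:R * k ^+ 3) * r ^+ 2.
Let d0 := c0 ^+ 2 + 2%:R * x * (c1 * c4 + c2 * c3).
Let d1 := 2%:R * c0 * c1 + x * (2%:R * c2 * c4 + c3 ^+ 2).
Let d2 := 2%:R * c0 * c2 + c1 ^+ 2 + 2%:R * x * c3 * c4.
Let d3 := 2%:R * (c0 * c3 + c1 * c2) + x * c4 ^+ 2.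
Let d4 := 2%:R * (c0 * c4 + c1 * c3) + c2 ^+ 2.

Lemma trace1 : P ^+ 3 * trace_poly s 1 = c0.
Proof.
transitivity (k * P ^+ 2 - 5%:R * k ^+ 2 * P ^+ 1 + 5%:R * k ^+ 3); last by rewrite /c0 /P; ring.
by rewrite -sP /= !monoE; ring.
Qed.

Lemma trace2 : P ^+ 6 * trace_poly s 2 = d0.
Proof.
transitivity (11%:R * k ^+ 2 * P ^+ 4 - 12%:R * 5%:R * k ^+ 3 * P ^+ 3 + 7%:R * 5%:R ^+ 2 * k ^+ 4
  * P ^+ 2 - 2%:R * 5%:R ^+ 3 * k ^+ 5 * P ^+ 1 + 5%:R ^+ 3 * k ^+ 6).
  by rewrite -{1 2 3 4 5}sP /= !monoE; ring.
by rewrite /d0 /c0 /c1 /c2 /c3 /c4 /P; ring: pp xpr xr ek.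
Qed.

Lemma trace3 : P ^+ 9 * trace_poly s 3 =
  d0 * c0 + x * (d1 * c4 + d2 * c3 + d3 * c2 + d4 * c1).
Proof.
transitivity (- 3%:R * k ^+ 2 * P ^+ 7 + 79%:R * k ^+ 3 * P ^+ 6 - 27%:R * 5%:R ^+ 2 * k ^+ 4 * P
  ^+ 5 + 114%:R * 5%:R ^+ 2 * k ^+ 5 * P ^+ 4 - 58%:R * 5%:R ^+ 3 * k ^+ 6 * P ^+ 3 + 18%:R * 5%:R
  ^+ 4 * k ^+ 7 * P ^+ 2 - 3%:R * 5%:R ^+ 5 * k ^+ 8 * P ^+ 1 + 5%:R ^+ 5 * k ^+ 9).
  by rewrite -{1 2 3 4 5 6 7 8}sP /= !monoE; ring.
by rewrite /d0 /d1 /d2 /d3 /d4 /c0 /c1 /c2 /c3 /c4 /P; ring: pp xpr xr ek.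
Qed.

Lemma trace4 : P ^+ 12 * trace_poly s 4 = d0 ^+ 2 + 2%:R * x * (d1 * d4 + d2 * d3).
Proof.
transitivity (- 24%:R * k ^+ 3 * P ^+ 9 + 27%:R * 5%:R ^+ 2 * k ^+ 4 * P ^+ 8 - 268%:R * 5%:R ^+ 2
  * k ^+ 5 * P ^+ 7 + 1492%:R * 5%:R ^+ 2 * k ^+ 6 * P ^+ 6 - 212%:R * 5%:R ^+ 4 * k ^+ 7 * P ^+ 5
  + 507%:R * 5%:R ^+ 4 * k ^+ 8 * P ^+ 4 - 164%:R * 5%:R ^+ 5 * k ^+ 9 * P ^+ 3 + 34%:R * 5%:R ^+
  6 * k ^+ 10 * P ^+ 2 - 4%:R * 5%:R ^+ 7 * k ^+ 11 * P ^+ 1 + 5%:R ^+ 7 * k ^+ 12).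
  by rewrite -{1 2 3 4 5 6 7 8 9 10}sP /= !monoE; ring.
by rewrite /d0 /d1 /d2 /d3 /d4 /c0 /c1 /c2 /c3 /c4 /P; ring: pp xpr xr ek.
Qed.

End Traces.

Lemma recombineM (R : comNzRingType) (a0 a1 a2 a3 a4 b0 b1 b2 b3 b4 : fps R) :
  recombine a0 a1 a2 a3 a4 * recombine b0 b1 b2 b3 b4 =
  recombine (a0 * b0 + fpsX * (a1 * b4 + a2 * b3 + a3 * b2 + a4 * b1))
    (a0 * b1 + a1 * b0 + fpsX * (a2 * b4 + a3 * b3 + a4 * b2))
    (a0 * b2 + a1 * b1 + a2 * b0 + fpsX * (a3 * b4 + a4 * b3))
    (a0 * b3 + a1 * b2 + a2 * b1 + a3 * b0 + fpsX * (a4 * b4))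
    (a0 * b4 + a1 * b3 + a2 * b2 + a3 * b1 + a4 * b0).
Proof. by rewrite /recombine !rmorphD !rmorphM !rmorphD !rmorphM /= dilX //; ring. Qed.

Definition al : fps int := 1 - uu - uu ^+ 2.
Definition be : fps int := 1 - vv - vv ^+ 2.

Lemma uu0E : uu 0%N = 0. Proof. by rewrite uuE fpsXME. Qed.

Lemma vv0E : vv 0%N = 0. Proof. by rewrite vvE fpsXnME. Qed.

Lemma be0E : be 0%N = 1.
Proof. by rewrite /be !fpsBE fps1E expr2 fpsM0E vv0E. Qed.

Lemma al0E : al 0%N = 1.
Proof. by rewrite /al !fpsBE fps1E expr2 fpsM0E uu0E. Qed.

Lemma dil_kk : dil 5 kk = uu * vv ^+ 2.
Proof. by rewrite kkE uuE vvE !(rmorphXn, rmorphM) /= dilX //; ring. Qed.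

(* [x ^ 3 a / b ^ 2] with [a = f(x) / f(x ^ 25)] and [b = f(x ^ 2) / f(x ^ 50)]. *)
Definition zz : fps int :=
  locked (fpsX ^+ 3 * dil 5 (rho2 ^+ 2 * fps_inv rho) * al * fps_inv be ^+ 2).

Lemma zz_be : zz * (uu * be ^+ 2) = vv ^+ 2 * al.
Proof.
rewrite /zz -lock !(rmorphXn, rmorphM) /=.
have beV : be * fps_inv be = 1 by rewrite fps_mulfV ?be0E.
have rV : dil 5 rho * dil 5 (fps_inv rho) = 1.
  by rewrite -rmorphM fps_mulfV ?rmorph1 ?rho0E.
transitivity (fpsX ^+ 4 * dil 5 rho2 ^+ 2 * al * (dil 5 rho * dil 5 (fps_inv rho)) *
  (be * fps_inv be) ^+ 2).
  by rewrite [in LHS]uuE; ring.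
by rewrite beV rV vvE; ring.
Qed.

Lemma cancel_uu_be n f g : (uu * be ^+ 2) ^+ n * f = (uu * be ^+ 2) ^+ n * g -> f = g.
Proof.
rewrite uuE => E; apply: (@fpsXM_inj _ n).
apply: (@fps_mulfI _ ((dil 5 rho * be ^+ 2) ^+ n)).
  by rewrite !(fpsX0E, fpsM0E) be0E dil0E rho0E !expr1n.
have comm h : (dil 5 rho * be ^+ 2) ^+ n * (fpsX ^+ n * h) =
    (fpsX * dil 5 rho * be ^+ 2) ^+ n * h by rewrite !exprMn; ring.
by rewrite !comm.
Qed.

(** By [ss_eta], f_5 and f_10 cancel in s(q) s(q^5), which leaves the square of q^3 f_1 f_50^2 /
    (f_2^2 f_25). *)
Lemma zz_sqr : zz ^+ 2 = ss * dil 5 ss.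
Proof.
have E := ss_eta; have E5 := congr1 (dil 5) ss_eta.
rewrite !(rmorphXn, rmorphM) /= !dil_dil // dilX // in E5.
rewrite -[(5 * 2)%N]/10%N -[(5 * 5)%N]/25%N -[(5 * 10)%N]/50%N in E5.
have Ea := euler_uu; have Eb := euler_vv; rewrite -/al in Ea; rewrite -/be in Eb.
have Ez := zz_be.
move: E E5 Ea Eb; set f2 := dil 2 eul; set f5 := dil 5 eul; set f10 := dil 10 eul.
set f25 := dil 25 eul; set f50 := dil 50 eul => E E5 Ea Eb.
have c0 : (f2 ^+ 4 * f25 ^+ 2 * f5 ^+ 2 * f10 ^+ 4 * (dil 5 rho) ^+ 2 * (dil 5 rho2) ^+ 4) 0%N = 1.
  by rewrite !(fpsX0E, fpsM0E) rho2E !dil0E euler0E rho0E !expr1n.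
apply: (fps_mulfI c0); apply: (@fpsXM_inj _ 2).
transitivity ((ss * (f2 ^+ 4 * f5 ^+ 2)) * (dil 5 ss * (f10 ^+ 4 * f25 ^+ 2)) *
  (fpsX * dil 5 rho) ^+ 2 * (dil 5 rho2) ^+ 4); last by ring.
rewrite E E5.
transitivity ((zz * uu) ^+ 2 * f25 ^+ 2 * f5 ^+ 2 * f10 ^+ 4 * (dil 5 rho2 * f2) ^+ 4).
  by rewrite uuE; ring.
rewrite Eb.
transitivity ((zz * (uu * be ^+ 2)) ^+ 2 * f25 ^+ 2 * f5 ^+ 2 * f10 ^+ 4 * f50 ^+ 4); first by ring.
rewrite Ez.
transitivity (vv ^+ 4 * (f25 * al) ^+ 2 * f5 ^+ 2 * f10 ^+ 4 * f50 ^+ 4); first by ring.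
by rewrite -Ea vvE; ring.
Qed.

Definition AA : fps int :=
  locked (fpsX ^+ 5 * (dil 25 eul * dil 50 eul ^+ 2) * fps_inv (eul * dil 2 eul ^+ 2)).

Lemma eul_eul2_0E : (eul * dil 2 eul ^+ 2) 0%N = 1.
Proof. by rewrite !(fpsX0E, fpsM0E) dil0E euler0E. Qed.

Lemma AA_euler : AA * (eul * dil 2 eul ^+ 2) = fpsX ^+ 5 * (dil 25 eul * dil 50 eul ^+ 2).
Proof.
rewrite /AA -lock; have W0 := eul_eul2_0E; set W := eul * _ in W0 *.
transitivity (fpsX ^+ 5 * (dil 25 eul * dil 50 eul ^+ 2) * (W * fps_inv W)); first by ring.
by rewrite fps_mulfV ?mulr1.
Qed.

Lemma AA_kk : AA * (al * be ^+ 2) = dil 5 kk.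
Proof.
have c0 : (dil 25 eul * dil 50 eul ^+ 2) 0%N = 1.
  by rewrite !(fpsX0E, fpsM0E) !dil0E euler0E.
apply: (fps_mulfI c0).
transitivity (AA * (dil 25 eul * al) * (dil 50 eul * be) ^+ 2); first by ring.
rewrite -euler_uu -euler_vv dil_kk uuE vvE.
transitivity (AA * (eul * dil 2 eul ^+ 2) * dil 5 rho * dil 5 rho2 ^+ 2); first by ring.
by rewrite AA_euler; ring.
Qed.

Local Notation s := (dil 5 ss).

Lemma dil_PP : dil 5 PP = 1 + uu * vv ^+ 2 - (uu * vv ^+ 2) ^+ 2.
Proof. by rewrite /PP rmorphB rmorphD rmorph1 rmorphXn /= dil_kk. Qed.

Lemma dil_ss_PP : s * dil 5 PP = uu * vv ^+ 2.
Proof. by rewrite -rmorphM ss_PP /= dil_kk. Qed.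

Lemma zz_charpoly : zz ^+ 5 =
  (5%:R * s - 25%:R * s ^+ 2 + 25%:R * s ^+ 3) * zz ^+ 4 -
  (- 15%:R * s ^+ 2 + 25%:R * s ^+ 3) * zz ^+ 3 +
  (- 5%:R * s ^+ 2 + 15%:R * s ^+ 3) * zz ^+ 2 -
  5%:R * s ^+ 3 * zz + s ^+ 3.
Proof.
have := charpoly_uv uu_vv; rewrite -dil_PP -dil_ss_PP -/al -/be -zz_be.
set d := uu * be ^+ 2; set P := dil 5 PP => E.
have P0 : (P ^+ 3) 0%N = 1 by rewrite fpsX0E dil0E PP0E.
by apply: (fps_mulfI P0); apply: (@cancel_uu_be 5); rewrite -/d; ring: E.
Qed.

Lemma zz_kernel : s * (1 - 5%:R * s) ^+ 4 * AA =
  (s ^+ 2 + 65%:R * s ^+ 3 + 75%:R * s ^+ 4 - 125%:R * s ^+ 5) +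
  (26%:R * s ^+ 2 - 40%:R * s ^+ 3 - 550%:R * s ^+ 4 + 500%:R * s ^+ 5) * zz +
  (s - 155%:R * s ^+ 2 - 375%:R * s ^+ 3 + 1875%:R * s ^+ 4 - 1250%:R * s ^+ 5) * zz ^+ 2 +
  (- 14%:R * s - 150%:R * s ^+ 2 + 1600%:R * s ^+ 3 - 2750%:R * s ^+ 4 + 1250%:R * s ^+ 5) * zz ^+
    3 +
  (6%:R + 60%:R * s - 50%:R * s ^+ 2) * zz ^+ 4.
Proof.
have := kernel_uv uu_vv; rewrite -dil_PP -/al -/be -zz_be.
(* 1 - 4k - k^2 = P - 5k, and k = s P. *)
have -> : 1 - 4%:R * (uu * vv ^+ 2) - (uu * vv ^+ 2) ^+ 2 = dil 5 PP * (1 - 5%:R * s).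
  by rewrite mulrBr mulr1 [X in _ = _ - X]mulrCA [dil 5 PP * s]mulrC dil_ss_PP dil_PP; ring.
have K2 : (uu * vv ^+ 2) ^+ 2 = s * dil 5 PP * (AA * (al * be ^+ 2)).
  by rewrite AA_kk dil_kk dil_ss_PP; ring.
rewrite {1}K2 -dil_ss_PP.
set d := uu * be ^+ 2; set P := dil 5 PP => E.
have P0 : (al * P ^+ 5) 0%N = 1 by rewrite !(fpsX0E, fpsM0E) dil0E PP0E al0E.
apply: (fps_mulfI P0); apply: (@cancel_uu_be 4).
transitivity (s * P * (AA * (al * be ^+ 2)) * (P * (1 - 5%:R * s)) ^+ 4 * uu ^+ 4 * be ^+ 6).
  by rewrite /d; ring.
by rewrite E /d; ring.
Qed.

(** The monomials 1, u, u^2, u v, u^2 v lie in the residues 0 to 4, so [components_uv] already is a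
    5-dissection; [rho2_kk] simplifies its coefficients. *)
Lemma zz_components : dil 5 (PP ^+ 3) * zz =
  recombine (kk * (1 - 3%:R * kk - kk ^+ 2 + 3%:R * kk ^+ 3 + kk ^+ 4))
    (kk * (- 2%:R + 2%:R * kk + kk ^+ 2 + kk ^+ 3) * ((1 + kk) * rho))
    ((1 - kk) * (kk * (3%:R + 2%:R * kk + kk ^+ 2 + kk ^+ 3)) * rho2)
    ((1 - kk + 2%:R * kk ^+ 2 - 3%:R * kk ^+ 3) * ((1 + kk) * rho) * rho2)
    ((1 - kk) * (- 1 + kk - 2%:R * kk ^+ 2 - 2%:R * kk ^+ 3) * rho2 ^+ 2).
Proof.
have := components_uv uu_vv; rewrite -dil_PP -/al -/be -zz_be -dil_kk => E.
apply: (@cancel_uu_be 1); rewrite expr1 rmorphXn /=.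
transitivity (zz * (uu * be ^+ 2) * dil 5 PP ^+ 3); first by ring.
rewrite E; congr (_ * _).
have w := congr1 (dil 5) rho2_kk; rewrite [LHS]rmorphM [RHS]rmorphM rmorphXn rmorphB rmorphD
  rmorph1 /= in w.
rewrite /recombine !(rmorphXn, rmorphB, rmorphD, rmorphN, rmorph1, rmorph_nat, rmorphM) /= uuE vvE.
move: w; move: (dil 5 kk) (dil 5 rho) (dil 5 rho2) => k r r2 w.
transitivity (k * (1 - 3%:R * k - k ^+ 2 + 3%:R * k ^+ 3 + k ^+ 4) +
  k * (- 2%:R + 2%:R * k + k ^+ 2 + k ^+ 3) * ((1 + k) * r) * fpsX +
  k * (3%:R + 2%:R * k + k ^+ 2 + k ^+ 3) * ((1 + k) * r ^+ 2) * fpsX ^+ 2 +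
  (1 - k + 2%:R * k ^+ 2 - 3%:R * k ^+ 3) * (1 + k) * r * r2 * fpsX ^+ 3 +
  (- 1 + k - 2%:R * k ^+ 2 - 2%:R * k ^+ 3) * ((1 + k) * r ^+ 2) * r2 * fpsX ^+ 4); first by ring.
by rewrite -w; ring.
Qed.

(** * Traces of the powers of zz *)

(** PP(q^5)^(3n) passes through the section as PP^(3n), and turns [zz ^+ n] into a power of an
    explicit [recombine]. *)
Lemma dissect_zz n : (n < 5)%N -> dissect 5 0 (zz ^+ n) = trace_poly ss n.
Proof.
have PPn m : (PP ^+ (3 * m)) 0%N = 1 by rewrite fpsX0E PP0E expr1n.
move=> ltn5; apply: (fps_mulfI (PPn n)).
rewrite -dissect_dilM // exprM [dil 5 _]rmorphXn -exprMn zz_components.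
set p := (1 + kk) * rho.
have pp : p ^+ 2 = rho2 - kk ^+ 2 * rho2.
  transitivity ((1 + kk) * ((1 + kk) * rho ^+ 2)); first by rewrite /p; ring.
  by rewrite -rho2_kk; ring.
have xpr : fpsX * p * rho2 ^+ 2 = kk + kk ^+ 2.
  by transitivity ((1 + kk) * (fpsX * rho * rho2 ^+ 2)); [rewrite /p; ring | rewrite -kkE; ring].
have ek : fpsX ^+ 2 * rho2 ^+ 5 * kk = fpsX ^+ 2 * rho2 ^+ 5 - kk ^+ 2 - kk ^+ 3.
  have E : fpsX ^+ 2 * rho2 ^+ 4 * ((1 - kk) * rho2) = kk ^+ 2 * (1 + kk).
    rewrite rho2_kk; transitivity ((fpsX * rho * rho2 ^+ 2) ^+ 2 * (1 + kk)); first by ring.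
    by rewrite -kkE.
  transitivity (fpsX ^+ 2 * rho2 ^+ 5 - fpsX ^+ 2 * rho2 ^+ 4 * ((1 - kk) * rho2)); first by ring.
  by rewrite E; ring.
have e0 := erefl (fpsX ^+ 2 * rho2 ^+ 5).
case: n ltn5 => [|[|[|[|[|//]]]]] _.
- by rewrite !expr0 mul1r; apply: fpsP => m; rewrite dissectE addn0 !fps1E muln_eq0.
- by rewrite expr1 dissect_recombine // -exprM (trace1 ss_PP).
- rewrite [recombine _ _ _ _ _ ^+ 2]expr2 recombineM dissect_recombine // -exprM.
  by rewrite (trace2 pp xpr e0 ek ss_PP) /=; ring.
- rewrite [recombine _ _ _ _ _ ^+ 3]exprSr [recombine _ _ _ _ _ ^+ 2]expr2 !recombineM.
  by rewrite dissect_recombine // -exprM (trace3 pp xpr e0 ek ss_PP) /=; ring.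
rewrite [recombine _ _ _ _ _ ^+ 4](exprD _ 2 2) [recombine _ _ _ _ _ ^+ 2]expr2 !recombineM.
by rewrite dissect_recombine // -exprM (trace4 pp xpr e0 ek ss_PP) /=; ring.
Qed.

(** * The operators on expansions in the Hauptmodul *)

Lemma ss_unit : exists2 w : fps int, w 0%N = 1 & ss = fpsX * w.
Proof.
exists (rho * rho2 ^+ 2 * fps_inv PP); last by rewrite ssE kkE !mulrA.
by rewrite !(fpsX0E, fpsM0E) fps_inv0 ?PP0E // rho2E dil0E rho0E.
Qed.

Lemma ss0E : ss 0%N = 0.
Proof. by have [w _ ->] := ss_unit; rewrite fpsXME. Qed.

Lemma ss_expI m f g : ss ^+ m * f = ss ^+ m * g -> f = g.
Proof.
have [w w0 ->] := ss_unit; rewrite exprMn -!mulrA => /fpsXM_inj.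
by apply: fps_mulfI; rewrite fpsX0E w0 expr1n.
Qed.

(** The series in q whose expansion in powers of [ss] has coefficients [c]. As a ring morphism it
    allows computing with [fpsX] in place of [ss]. *)
Definition K (c : fps int) : fps int := fps_comp ss c.

Lemma KB : {morph K : c d / c - d}.
Proof.
move=> c d; apply/eqP; rewrite eq_sym subr_eq; apply/eqP.
by rewrite -compD subrK.
Qed.

HB.instance Definition _ := GRing.isZmodMorphism.Build _ _ K KB.
HB.instance Definition _ :=
  GRing.isMonoidMorphism.Build _ _ K (conj (comp1 ss) (compM ss0E)).

Lemma KX : K fpsX = ss. Proof. exact: compX ss0E. Qed.

Lemma KCM a c : K (fpsC a * c) = fpsC a * K c. Proof. exact: compCM. Qed.

Lemma K0E c : K c 0%N = c 0%N.
Proof. by rewrite /K fps_compE big_ord1 expr0 mulr1. Qed.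

Lemma eqX_K N c : eqX N (K c) 0 -> eqX N c 0.
Proof.
move=> E; elim/ltn_ind => n IH ltnN; have := E n ltnN.
rewrite /K fps_compE big_ord_recr big1 /= => [|i _]; last first.
  by rewrite IH ?mul0r //; have := ltn_ord i; lia.
have [w w0 ->] := ss_unit.
by rewrite exprMn fpsXnME leqnn subnn fpsX0E w0 expr1n mulr1 add0r.
Qed.

Definition fps_drop m (c : fps int) : fps int := Fps (fun j => c (m + j)%N).

Lemma fps_dropE m c j : fps_drop m c j = c (m + j)%N. Proof. by []. Qed.

Lemma fps_dropK m c : eqX m c 0 -> fpsX ^+ m * fps_drop m c = c.
Proof.
move=> c0; apply: fpsP => n; rewrite fpsXnME fps_dropE.
by case: leqP => [/subnKC -> //|/c0 ->].
Qed.

Notation U := (@dissect int 5 0).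

Lemma UCM a f : U (fpsC a * f) = fpsC a * U f.
Proof. by apply: fpsP => n; rewrite dissectE !fpsCME. Qed.

Lemma U_dil g f : U (dil 5 g * f) = g * U f.
Proof. exact: dissect_dilM. Qed.

(* If [u m] lists the coefficients of [U (B * ss ^+ m)] in powers of [ss], this is the action of
   [f |-> U (B * f)] on coefficients; the sum stops where [u m j] vanishes. *)
Definition fps_act (u : nat -> fps int) (c : fps int) : fps int :=
  Fps (fun j => \sum_(m < 5 * j.+1) c m * u m j).

Lemma fps_actE u c j : fps_act u c j = \sum_(m < 5 * j.+1) c m * u m j.
Proof. by []. Qed.

(** Justifies the cutoff in [fps_act]: [ss ^+ m] has order [m], which [U] divides by 5, and [ss] has
    order 1. *)
Lemma U_act_van B u : (forall m, U (B * ss ^+ m) = K (u m)) ->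
  forall m j, (5 * j.+1 <= m)%N -> u m j = 0.
Proof.
move=> Bu m j lejm; apply: (@eqX_K j.+1) => //; rewrite -Bu.
rewrite -[0](raddf0 U); apply: eqX_dissect => //; apply: eqX_leq lejm _.
exact/eqX0_mull/eqX0_exp/ss0E.
Qed.

Lemma U_act B u c : (forall m, U (B * ss ^+ m) = K (u m)) ->
  U (B * K c) = K (fps_act u c).
Proof.
move=> Bu; apply: eqXP => N.
apply: (@eqX_trans _ _ (U (B * \sum_(m < 5 * N) fpsC (c m) * ss ^+ m))).
  by apply: eqX_dissect => //; apply: eqXM => //; apply/comp_eqX/ss0E.
have -> : U (B * \sum_(m < 5 * N) fpsC (c m) * ss ^+ m) = K (\sum_(m < 5 * N) fpsC (c m) * u m).
  rewrite mulr_sumr !raddf_sum; apply: eq_bigr => m _.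
  by rewrite /= KCM -Bu -UCM mulrCA.
apply: eqX_comp => j ltjN; rewrite fps_sumE fps_actE.
rewrite (big_ord_widen (5 * N) (fun m => c m * u m j)) ?leq_mul // [RHS]big_mkcond /=.
apply: eq_bigr => m _; rewrite fpsCME; case: ltnP => // lem.
by rewrite (U_act_van Bu) ?mulr0.
Qed.

(** Expansion of [U (zz ^+ n)]: the coefficients in [zz_charpoly] are series in q^5, so the equation
    passes through [U] as a recurrence. *)
Fixpoint Zc (n : nat) : fps int :=
  match n with
  | (((((m.+1) as m1).+1 as m2).+1 as m3).+1 as m4).+1 =>
      (mono fpsX 1 1 1 - mono fpsX 1 2 2 + mono fpsX 1 2 3) * Zc m4 -
      (mono fpsX 1 2 3 - mono fpsX 3 1 2) * Zc m3 +
      (mono fpsX 3 1 3 - mono fpsX 1 1 2) * Zc m2 -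
      mono fpsX 1 1 3 * Zc m1 + mono fpsX 1 0 3 * Zc m
  | n' => trace_poly fpsX n'
  end.

Lemma ZcE m : Zc (m + 5) =
  (mono fpsX 1 1 1 - mono fpsX 1 2 2 + mono fpsX 1 2 3) * Zc (m + 4) -
  (mono fpsX 1 2 3 - mono fpsX 3 1 2) * Zc (m + 3) +
  (mono fpsX 3 1 3 - mono fpsX 1 1 2) * Zc (m + 2) -
  mono fpsX 1 1 3 * Zc (m + 1) + mono fpsX 1 0 3 * Zc m.
Proof. by rewrite (addnC m 5) (addnC m 4) (addnC m 3) (addnC m 2) (addnC m 1). Qed.

Lemma Zc_small n : (n < 5)%N -> Zc n = trace_poly fpsX n.
Proof. by case: n => [|[|[|[|[|]]]]]. Qed.

Lemma mono_rmorph (R S : comNzRingType) (phi : {rmorphism R -> S}) x u v l :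
  phi (mono x u v l) = mono (phi x) u v l.
Proof. by rewrite !monoE !rmorphM !rmorphXn !rmorph_nat. Qed.

Lemma trace_poly_rmorph (R S : comNzRingType) (phi : {rmorphism R -> S}) x n :
  phi (trace_poly x n) = trace_poly (phi x) n.
Proof.
case: n => [|[|[|[|n]]]] /=; first exact: rmorph1.
- by rewrite rmorphD rmorphB !mono_rmorph.
- by rewrite rmorphD rmorphB rmorphD rmorphB !mono_rmorph.
- by rewrite rmorphD rmorphB rmorphD rmorphB rmorphD rmorphB rmorphD rmorphN !mono_rmorph.
by rewrite rmorphD rmorphB rmorphD rmorphB rmorphD rmorphB rmorphD rmorphB rmorphD rmorphN
  !mono_rmorph.
Qed.

Lemma U_zz n : U (zz ^+ n) = K (Zc n).
Proof.
elim/ltn_ind: n => n IH; have [ltn5|le5n] := ltnP n 5.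
  by rewrite dissect_zz // Zc_small // (trace_poly_rmorph K) /= KX.
have -> : n = (n - 5 + 5)%N by lia.
move: (n - 5)%N (subnK le5n) => m Em.
have [z1 z2 z3 z4] : [/\ U (zz ^+ (m + 1)) = K (Zc (m + 1)), U (zz ^+ (m + 2)) = K (Zc (m + 2)),
   U (zz ^+ (m + 3)) = K (Zc (m + 3)) & U (zz ^+ (m + 4)) = K (Zc (m + 4))].
  by split; apply: IH; lia.
have z0 : U (zz ^+ m) = K (Zc m) by apply: IH; lia.
have -> : zz ^+ (m + 5) =
  dil 5 (mono ss 1 1 1 - mono ss 1 2 2 + mono ss 1 2 3) * zz ^+ (m + 4) -
  dil 5 (mono ss 1 2 3 - mono ss 3 1 2) * zz ^+ (m + 3) +
  dil 5 (mono ss 3 1 3 - mono ss 1 1 2) * zz ^+ (m + 2) -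
  dil 5 (mono ss 1 1 3) * zz ^+ (m + 1) + dil 5 (mono ss 1 0 3) * zz ^+ m.
  rewrite exprD zz_charpoly !exprD !(rmorphB, rmorphD) /= !mono_rmorph /= !monoE; ring.
rewrite raddfD raddfB raddfD raddfB /= !U_dil z0 z1 z2 z3 z4 ZcE.
rewrite [RHS]rmorphD rmorphB rmorphD rmorphB !rmorphM /=.
by rewrite !(rmorphB, rmorphD) /= !mono_rmorph /= KX.
Qed.

(** * Valuations *)

Definition pv (k : nat) (a : int) := exists b : int, a = 5%:R ^+ k * b.

Lemma pv_0 a : pv 0 a. Proof. by exists a; rewrite mul1r. Qed.

Lemma pv0 k : pv k 0. Proof. by exists 0; rewrite mulr0. Qed.

Lemma pvD k a b : pv k a -> pv k b -> pv k (a + b).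
Proof. by move=> [a' ->] [b' ->]; exists (a' + b'); rewrite mulrDr. Qed.

Lemma pvN k a : pv k a -> pv k (- a).
Proof. by move=> [a' ->]; exists (- a'); rewrite mulrN. Qed.

Lemma pvM i j k a b : (k <= i + j)%N -> pv i a -> pv j b -> pv k (a * b).
Proof.
move=> lek [a' ->] [b' ->]; exists (5%:R ^+ (i + j - k) * (a' * b')).
by rewrite [RHS]mulrA -exprD subnKC // exprD mulrACA.
Qed.

Lemma pv_leq i k a : (k <= i)%N -> pv i a -> pv k a.
Proof.
by move=> leki pa; rewrite -[a]mulr1; apply: (pvM (j := 0)) pa (pv_0 1); rewrite addn0.
Qed.

Lemma pvMr k a b : pv k b -> pv k (a * b).
Proof. exact: pvM (pv_0 a). Qed.

Lemma pv_sum k (I : Type) (r : seq I) (P : pred I) (F : I -> int) :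
  (forall i, P i -> pv k (F i)) -> pv k (\sum_(i <- r | P i) F i).
Proof. by move=> pF; elim/big_rec: _ => [|i a /pF]; [exact: pv0 | apply: pvD]. Qed.

(* The valuation of [c j] is at least the floor of [(5 j - a) / 6]. *)
Definition slope (a : nat) (c : fps int) :=
  forall j k, (6 * k + a <= 5 * j)%N -> pv k (c j).

Lemma slopeD a c d : slope a c -> slope a d -> slope a (c + d).
Proof. by move=> sc sd j k lek; rewrite fpsDE; apply: pvD; [apply: sc | apply: sd]. Qed.

Lemma slopeN a c : slope a c -> slope a (- c).
Proof. by move=> sc j k lek; rewrite fpsNE; apply/pvN/sc. Qed.

Lemma monoME u v l (c : fps int) j :
  (mono fpsX u v l * c) j = u%:R * (5%:R ^+ v * (if (l <= j)%N then c (j - l)%N else 0)).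
Proof. by rewrite monoE -!mulrA -natrX !fps_natME fpsXnME natrX. Qed.

Definition raises (b : nat) (p : fps int) :=
  forall a c a', (a + b <= a')%N -> slope a c -> slope a' (p * c).

Lemma raisesD b p q : raises b p -> raises b q -> raises b (p + q).
Proof.
by move=> rp rq a c a' lea sc; rewrite mulrDl; apply: slopeD; [apply: (rp a) | apply: (rq a)].
Qed.

Lemma raisesN b p : raises b p -> raises b (- p).
Proof. by move=> rp a c a' lea sc; rewrite mulNr; apply/slopeN/(rp a). Qed.

(** A shift by [l] costs [5 * l], and each factor 5 wins back 6. *)
Lemma raises_mono b u v l : (5 * l <= b + 6 * v)%N -> raises b (mono fpsX u v l).
Proof.
move=> lel a c a' lea sc j k lek; rewrite monoME; apply: pvMr.
case: ifP => lelj; last by rewrite mulr0; apply: pv0.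
apply: (@pvM v (k - v)); first by lia.
  by exists 1; rewrite mulr1.
by have [lekv|ltvk] := leqP k v; [rewrite (eqP lekv); apply: pv_0 | apply: sc; lia].
Qed.

(** The slack 5 comes from the floor: [6 * k <= 6 * v + 5] still forces [k <= v]. *)
Lemma slope_mono a u v l : (5 * l <= a + 6 * v + 5)%N -> slope a (mono fpsX u v l).
Proof.
move=> lel j k lek; rewrite -[mono _ _ _ _]mulr1 monoME fps1E; apply: pvMr.
case: ifP => lelj; last by rewrite mulr0; apply: pv0.
have [j0|] := eqVneq (j - l)%N 0%N; last by rewrite mulr0 => _; apply: pv0.
by apply: (@pvM v 0); [lia | exists 1; rewrite mulr1 | apply: pv_0].
Qed.

(** In the recurrence, the coefficient of the term [i] places back raises the offset by at most
    [3 * i]. *)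
Lemma slope_Zc n : slope (3 * n + 1) (Zc n).
Proof.
elim/ltn_ind: n => n IH; have [ltn5|le5n] := ltnP n 5.
  rewrite Zc_small //; case: n ltn5 {IH} => [|[|[|[|[|//]]]]] _ /=.
  - by move=> j k lek; rewrite fps1E; case: eqP => [|_]; [lia | apply: pv0].
  all: repeat first [apply: slopeD | apply: slopeN | by apply: slope_mono].
have -> : n = (n - 5 + 5)%N by lia.
move: (n - 5)%N (subnK le5n) => m Em.
rewrite ZcE; repeat first [apply: slopeD | apply: slopeN].
- apply: (_ : raises 3 _) (IH (m + 4)%N _); [|lia|lia].
  by repeat first [apply: raisesD | apply: raisesN | by apply: raises_mono].
- apply: (_ : raises 6 _) (IH (m + 3)%N _); [|lia|lia].
  by repeat first [apply: raisesD | apply: raisesN | by apply: raises_mono].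
- apply: (_ : raises 9 _) (IH (m + 2)%N _); [|lia|lia].
  by repeat first [apply: raisesD | apply: raisesN | by apply: raises_mono].
- by apply: (@raises_mono 12 1 1 3) (IH (m + 1)%N _); lia.
- by apply: (@raises_mono 15 1 0 3) (IH m _); lia.
Qed.

(** The right side of [zz_kernel] times [zz ^+ (2 * m)], with each power of [zz] replaced by the
    expansion of its image under [U]. *)
Definition Wc (m : nat) : fps int :=
  (mono fpsX 1 0 2 + mono fpsX 13 1 3 + mono fpsX 3 2 4 - mono fpsX 1 3 5) * Zc (2 * m) +
  (mono fpsX 26 0 2 - mono fpsX 8 1 3 - mono fpsX 22 2 4 + mono fpsX 4 3 5) * Zc (2 * m + 1) +
  (mono fpsX 1 0 1 - mono fpsX 31 1 2 - mono fpsX 3 3 3 + mono fpsX 3 4 4 - mono fpsX 2 4 5) *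
    Zc (2 * m + 2) +
  (- mono fpsX 14 0 1 - mono fpsX 6 2 2 + mono fpsX 64 2 3 - mono fpsX 22 3 4 +
    mono fpsX 2 4 5) * Zc (2 * m + 3) +
  (mono fpsX 6 0 0 + mono fpsX 12 1 1 - mono fpsX 2 2 2) * Zc (2 * m + 4).

Lemma slope_Wc m : slope (6 * m + 15) (Wc m).
Proof.
repeat apply: slopeD.
- apply: (_ : raises 14 _) (@slope_Zc _); last lia.
  by repeat first [apply: raisesD | apply: raisesN | by apply: raises_mono].
- apply: (_ : raises 11 _) (@slope_Zc _); last lia.
  by repeat first [apply: raisesD | apply: raisesN | by apply: raises_mono].
- apply: (_ : raises 8 _) (@slope_Zc _); last lia.
  by repeat first [apply: raisesD | apply: raisesN | by apply: raises_mono].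
- apply: (_ : raises 5 _) (@slope_Zc _); last lia.
  by repeat first [apply: raisesD | apply: raisesN | by apply: raises_mono].
apply: (_ : raises 2 _) (@slope_Zc _); last lia.
by repeat first [apply: raisesD | apply: raisesN | by apply: raises_mono].
Qed.

(** The multiplier comes from a series in q^5; before [U] it clears the denominator of [zz_kernel],
    and s(q)^m s(q^5)^m = [zz ^+ (2 * m)] leaves only powers of [zz]. *)
Lemma U_AA m :
  ss ^+ m.+1 * ((1 - 5%:R * ss) ^+ 4 * U (AA * ss ^+ m)) = K (Wc m).
Proof.
rewrite mulrA -U_dil.
have -> : dil 5 (ss ^+ m.+1 * (1 - 5%:R * ss) ^+ 4) * (AA * ss ^+ m) =
  dil 5 (mono ss 1 0 2 + mono ss 13 1 3 + mono ss 3 2 4 - mono ss 1 3 5) * zz ^+ (2 * m) +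
  dil 5 (mono ss 26 0 2 - mono ss 8 1 3 - mono ss 22 2 4 + mono ss 4 3 5) * zz ^+ (2 * m + 1) +
  dil 5 (mono ss 1 0 1 - mono ss 31 1 2 - mono ss 3 3 3 + mono ss 3 4 4 - mono ss 2 4 5) *
    zz ^+ (2 * m + 2) +
  dil 5 (- mono ss 14 0 1 - mono ss 6 2 2 + mono ss 64 2 3 - mono ss 22 3 4 +
    mono ss 2 4 5) * zz ^+ (2 * m + 3) +
  dil 5 (mono ss 6 0 0 + mono ss 12 1 1 - mono ss 2 2 2) * zz ^+ (2 * m + 4).
  have zz2 : zz ^+ (2 * m) = ss ^+ m * dil 5 ss ^+ m by rewrite exprM zz_sqr exprMn.
  have zzi i : zz ^+ (2 * m + i) = ss ^+ m * dil 5 ss ^+ m * zz ^+ i.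
    by rewrite (exprD zz (2 * m) i) zz2.
  rewrite !zzi zz2 !(rmorphB, rmorphD, rmorphN) /= !mono_rmorph /= !monoE.
  rewrite exprS [LHS](_ : _ = dil 5 ss * (1 - 5%:R * dil 5 ss) ^+ 4 * AA * (ss ^+ m * dil 5 ss ^+
    m)).
    by rewrite zz_kernel; ring.
  rewrite 2!dilM [dil 5 (_ ^+ m)]rmorphXn [dil 5 (_ ^+ 4)]rmorphXn /= dilB dil1 dilM rmorph_nat.
  by ring.
rewrite raddfD raddfD raddfD raddfD /= !U_dil !U_zz /Wc.
rewrite [RHS]rmorphD rmorphD rmorphD rmorphD !rmorphM /=.
by rewrite !(rmorphB, rmorphD, rmorphN) /= !mono_rmorph /= KX.
Qed.

(** Since [zz ^+ (2 * m)] is s(q)^m s(q^5)^m, its image under [U] is [ss ^+ m] times that of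
    [ss ^+ m]; the drop divides by [ss ^+ m]. *)
Definition um m := fps_drop m (Zc (2 * m)).

Definition geo : fps int := fps_inv (1 - 5%:R * fpsX).

Definition ua m := fps_drop m.+1 (Wc m) * geo ^+ 4.

Lemma geoE : (1 - 5%:R * fpsX) * geo = 1.
Proof. by rewrite fps_mulfV // fpsBE fps1E mulrC fpsXME subr0. Qed.

Lemma pv_geo j : pv j (geo j).
Proof.
elim: j => [|j IH]; first exact: pv_0.
have : ((1 - 5%:R * fpsX) * geo) j.+1 = 0 by rewrite geoE.
rewrite mulrBl mul1r -mulrA fpsBE fps_natME fpsXME => /eqP; rewrite subr_eq0 => /eqP ->.
by apply: (@pvM 1 j) => //; exists 1; rewrite mulr1.
Qed.

Lemma U_ss m : U (1 * ss ^+ m) = K (um m).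
Proof.
have E : ss ^+ m * U (1 * ss ^+ m) = K (Zc (2 * m)).
  by rewrite -U_dil mul1r rmorphXn /= -exprMn [_ * ss]mulrC -zz_sqr -exprM U_zz.
apply: (@ss_expI m); rewrite E -{1}(@fps_dropK m (Zc (2 * m))).
  by rewrite rmorphM rmorphXn /= KX.
by apply: eqX_K; rewrite -E mulrC; apply/eqX0_mull/eqX0_exp/ss0E.
Qed.

Lemma U_AAE m : U (AA * ss ^+ m) = K (ua m).
Proof.
have E := U_AA m; have gE := congr1 K geoE.
rewrite [LHS]rmorphM rmorphB !rmorph1 rmorphM rmorph_nat /= KX in gE.
have -> : U (AA * ss ^+ m) = (1 - 5%:R * ss) ^+ 4 * U (AA * ss ^+ m) * K geo ^+ 4.
  by rewrite mulrAC -exprMn gE expr1n mul1r.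
rewrite /ua rmorphM rmorphXn /=; congr (_ * _); apply: (@ss_expI m.+1).
rewrite E -{1}(@fps_dropK m.+1 (Wc m)).
  by rewrite rmorphM rmorphXn /= KX.
by apply: eqX_K; rewrite -E mulrC; apply/eqX0_mull/eqX0_exp/ss0E.
Qed.

(** The coefficient of index [i] in [geo] is divisible by 5^i, a growth steeper than 5/6. *)
Lemma slope_geo a c n : slope a c -> slope a (c * geo ^+ n).
Proof.
move=> sc; elim: n => [|n IH]; first by rewrite expr0 mulr1.
rewrite exprSr mulrA => j k lek; rewrite fpsME; apply: pv_sum => i _.
have lei : (i <= j)%N by rewrite -ltnS.
have [lekj|ltjk] := leqP k (j - i); first exact/pvMr/(pv_leq lekj)/pv_geo.
by apply: (@pvM (k - (j - i)) (j - i)); [lia | apply: IH; lia | apply: pv_geo].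
Qed.

(** Dropping [m] coefficients lowers the offset [6 * m + 1] by [5 * m]. *)
Lemma pv_um m j k : (6 * k + m + 1 <= 5 * j)%N -> pv k (um m j).
Proof. by move=> lek; apply: slope_Zc; lia. Qed.

Lemma pv_ua m j k : (6 * k + m + 10 <= 5 * j)%N -> pv k (ua m j).
Proof.
move=> lek; apply: (@slope_geo (m + 10)); last by lia.
by move=> i l lel; apply: slope_Wc; lia.
Qed.

Lemma ua_0 m : ua m 0%N = 0.
Proof.
rewrite -K0E -U_AAE dissectE addn0 muln0 fpsM0E.
by rewrite /AA -lock -(mulrA (fpsX ^+ 5)) fpsXnME mul0r.
Qed.

(** * The residues modulo 5 *)

Definition eq5 (f g : fps int) := exists h, f = g + 5%:R * h.

Lemma eq5_refl f : eq5 f f. Proof. by exists 0; rewrite mulr0 addr0. Qed.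

Lemma eq5_trans g f h : eq5 f g -> eq5 g h -> eq5 f h.
Proof. by move=> [a ->] [b ->]; exists (a + b); ring. Qed.

Lemma eq5D f g f' g' : eq5 f f' -> eq5 g g' -> eq5 (f + g) (f' + g').
Proof. by move=> [a ->] [b ->]; exists (a + b); ring. Qed.

Lemma eq5M f g f' g' : eq5 f f' -> eq5 g g' -> eq5 (f * g) (f' * g').
Proof. by move=> [a ->] [b ->]; exists (f' * b + a * g' + 5%:R * a * b); ring. Qed.

Lemma eq5_coef f g j : eq5 f g -> exists b, f j = g j + 5%:R * b.
Proof. by move=> [h ->]; exists (h j); rewrite fpsDE fps_natME. Qed.

(** Modulo 5, [zz_charpoly] is just [zz ^+ 5] = s(q^5)^3. *)
Lemma Zc_eq5 n : eq5 (Zc (n + 5)) (fpsX ^+ 3 * Zc n).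
Proof.
exists ((fpsX - 5%:R * fpsX ^+ 2 + 5%:R * fpsX ^+ 3) * Zc (n + 4) -
  (5%:R * fpsX ^+ 3 - 3%:R * fpsX ^+ 2) * Zc (n + 3) +
  (3%:R * fpsX ^+ 3 - fpsX ^+ 2) * Zc (n + 2) - fpsX ^+ 3 * Zc (n + 1)).
by rewrite ZcE !monoE; move: (Zc _) (Zc _) (Zc _) (Zc _) (Zc _) => a b c d e; ring.
Qed.

Lemma Zc_small_eq5 : [/\ eq5 (Zc 0) 1, eq5 (Zc 1) fpsX, eq5 (Zc 2) (fpsX ^+ 2),
  eq5 (Zc 3) (2%:R * fpsX ^+ 2 + 4%:R * fpsX ^+ 3) & eq5 (Zc 4) (fpsX ^+ 3)].
Proof.
have m5 u v l : eq5 (mono fpsX u v.+1 l) 0.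
  by exists (mono fpsX u v l); rewrite !monoE exprS; ring.
have m5N u v l : eq5 (- mono fpsX u v.+1 l) 0.
  by exists (- mono fpsX u v l); rewrite !monoE exprS; ring.
have z4 : eq5 (- mono fpsX 24 0 3) (fpsX ^+ 3).
  by exists (- 5%:R * fpsX ^+ 3); rewrite monoE; ring.
rewrite !Zc_small //=; split; first exact: eq5_refl.
- apply: eq5_trans (eq5D (eq5D (eq5_refl _) (m5N _ _ _)) (m5 _ _ _)) _.
  by exists 0; rewrite monoE; ring.
- apply: eq5_trans (eq5D (eq5D (eq5D (eq5D (eq5_refl _) (m5N _ _ _)) (m5 _ _ _)) (m5N _ _ _)) (m5
  _ _ _)) _.
  by exists (2%:R * fpsX ^+ 2); rewrite monoE; ring.
- apply: eq5_trans (eq5D (eq5D (eq5D (eq5D (eq5D (eq5D (eq5_refl _) (m5N _ _ _)) (m5 _ _ _)) (m5N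
  _ _ _)) (m5 _ _ _)) (m5N _ _ _)) (m5 _ _ _)) _.
  by exists (- fpsX ^+ 2 + 15%:R * fpsX ^+ 3); rewrite !monoE; ring.
apply: eq5_trans (eq5D (eq5D (eq5D (eq5D (eq5D (eq5D (eq5D (eq5D (eq5D z4 (m5 _ _ _)) (m5N _ _ _))
  (m5 _ _ _)) (m5N _ _ _)) (m5 _ _ _)) (m5N _ _ _)) (m5 _ _ _)) (m5N _ _ _)) (m5 _ _ _)) _.
by exists 0; ring.
Qed.

Lemma Wc_eq5 m : eq5 (Wc m) (fpsX ^+ 2 * Zc (2 * m) + fpsX ^+ 2 * Zc (2 * m + 1) +
  fpsX * Zc (2 * m + 2) + fpsX * Zc (2 * m + 3) + Zc (2 * m + 4)).
Proof.
exists ((13%:R * fpsX ^+ 3 + 15%:R * fpsX ^+ 4 - 25%:R * fpsX ^+ 5) * Zc (2 * m) +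
  (5%:R * fpsX ^+ 2 - 8%:R * fpsX ^+ 3 - 110%:R * fpsX ^+ 4 + 100%:R * fpsX ^+ 5) * Zc (2 * m + 1) +
  (- 31%:R * fpsX ^+ 2 - 75%:R * fpsX ^+ 3 + 375%:R * fpsX ^+ 4 - 250%:R * fpsX ^+ 5) * Zc (2 * m
    + 2) +
  (- 3%:R * fpsX - 30%:R * fpsX ^+ 2 + 320%:R * fpsX ^+ 3 - 550%:R * fpsX ^+ 4 + 250%:R * fpsX ^+
    5) *
     Zc (2 * m + 3) +
  (1 + 12%:R * fpsX - 10%:R * fpsX ^+ 2) * Zc (2 * m + 4)).
by rewrite /Wc !monoE; move: (Zc _) (Zc _) (Zc _) (Zc _) (Zc _) => a b c d e; ring.
Qed.

Lemma geo_eq5 : eq5 (geo ^+ 4) 1.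
Proof.
have g1 : eq5 geo 1.
  by exists (fpsX * geo); rewrite -{1}geoE; ring.
have -> : geo ^+ 4 = (geo * geo) * (geo * geo) by ring.
by have := eq5M (eq5M g1 g1) (eq5M g1 g1); rewrite !mulr1.
Qed.

Lemma fps_dropM m (c : fps int) : fps_drop m (fpsX ^+ m * c) = c.
Proof. by apply: fpsP => j; rewrite fps_dropE fpsXnME leq_addr addKn. Qed.

Lemma fps_drop_eq5 m f g : eq5 f g -> eq5 (fps_drop m f) (fps_drop m g).
Proof.
move=> [h ->]; exists (fps_drop m h); apply: fpsP => j.
by rewrite fps_dropE !fpsDE !fps_natME !fps_dropE.
Qed.

Lemma Zc_residues : [/\ eq5 (Zc 5) (fpsX ^+ 3), eq5 (Zc 6) (fpsX ^+ 4), eq5 (Zc 7) (fpsX ^+ 5),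
  eq5 (Zc 8) (2%:R * fpsX ^+ 5 + 4%:R * fpsX ^+ 6) & eq5 (Zc 9) (fpsX ^+ 6) /\ eq5 (Zc 10) (fpsX
    ^+ 6)].
Proof.
have [z0 z1 z2 z3 z4] := Zc_small_eq5.
have step n g : eq5 (Zc n) g -> eq5 (Zc (n + 5)) (fpsX ^+ 3 * g).
  by move=> zg; apply: eq5_trans (Zc_eq5 n) (eq5M (eq5_refl _) zg).
have := step 0%N _ z0; rewrite mulr1 => z5; have := step 5 _ z5; rewrite -exprD => z10.
have := step 1%N _ z1; rewrite -exprSr => z6; have := step 2 _ z2; rewrite -exprD => z7.
have := step 4 _ z4; rewrite -exprD => z9; have := step 3 _ z3; rewrite mulrDr => z8.
split=> //; apply: eq5_trans z8 _; exists 0; ring.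
Qed.

Lemma um_residues : [/\ eq5 (um 1) fpsX, eq5 (um 2) fpsX & eq5 (um 3) fpsX].
Proof.
have [_ _ z2 _ z4] := Zc_small_eq5; have [_ z6 _ _ _] := Zc_residues.
rewrite -(expr1 fpsX); split.
- by rewrite -(fps_dropM 1 (fpsX ^+ 1)) -exprD; apply: fps_drop_eq5.
- by rewrite -(fps_dropM 2 (fpsX ^+ 1)) -exprD; apply: fps_drop_eq5.
by rewrite -(fps_dropM 3 (fpsX ^+ 1)) -exprD; apply: fps_drop_eq5.
Qed.

(** In all four cases the coefficients add up to a multiple of 5, which is the linear condition in
    [odd_bound]. *)
Lemma ua_residues :
  [/\ eq5 (ua 0) (fpsX + 4%:R * fpsX ^+ 3), eq5 (ua 1) (fpsX ^+ 2 + 4%:R * fpsX ^+ 3),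
      eq5 (ua 2) 0 & eq5 (ua 3) (4%:R * fpsX ^+ 2 + fpsX ^+ 3)].
Proof.
have [z0 z1 z2 z3 z4] := Zc_small_eq5; have [z5 z6 z7 z8 [z9 z10]] := Zc_residues.
have red m g : eq5 (Wc m) (fpsX ^+ m.+1 * g) -> eq5 (ua m) g.
  move=> /(fps_drop_eq5 m.+1); rewrite fps_dropM => dg.
  by rewrite -[g]mulr1; apply: eq5M geo_eq5.
have W m a b c d e : eq5 (Zc (2 * m)) a -> eq5 (Zc (2 * m + 1)) b -> eq5 (Zc (2 * m + 2)) c ->
    eq5 (Zc (2 * m + 3)) d -> eq5 (Zc (2 * m + 4)) e ->
    eq5 (Wc m) (fpsX ^+ 2 * a + fpsX ^+ 2 * b + fpsX * c + fpsX * d + e).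
  move=> za zb zc zd ze; apply: eq5_trans (Wc_eq5 m) _.
  by apply: eq5D ze; do ?[apply: eq5D | apply: eq5M]; rewrite //; apply: eq5_refl.
split; apply: red.
- by apply: eq5_trans (W 0%N _ _ _ _ _ z0 z1 z2 z3 z4) _; exists (fpsX ^+ 3); ring.
- by apply: eq5_trans (W 1%N _ _ _ _ _ z2 z3 z4 z5 z6) _; exists (fpsX ^+ 4); ring.
- by apply: eq5_trans (W 2 _ _ _ _ _ z4 z5 z6 z7 z8) _; exists (fpsX ^+ 5 + fpsX ^+ 6); ring.
by apply: eq5_trans (W 3 _ _ _ _ _ z6 z7 z8 z9 z10) _; exists (fpsX ^+ 7); ring.
Qed.

(** * Gaining a factor 5 every second step *)

(** Divisibility by 5 to the floor of (m + 2) / 6, a condition that reappears after two steps and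
    division by 5. *)
Definition even_bound (c : fps int) := forall m k, (6 * k <= m + 2)%N -> pv k (c m).

(* Modulo 5, [U] maps [ss], [ss ^+ 2] and [ss ^+ 3] to the same series. *)
Definition odd_bound (c : fps int) :=
  [/\ c 0%N = 0, slope 13 c & pv 1 (c 1%N + c 2 + c 3)].

Lemma fps_act_split u c j :
  fps_act u c j = c 0%N * u 0%N j + c 1%N * u 1%N j + c 2 * u 2 j + c 3 * u 3 j +
    \sum_(m < 5 * j + 1) c (4 + m)%N * u (4 + m)%N j.
Proof.
rewrite fps_actE -(big_mkord xpredT (fun m => c m * u m j)).
rewrite (_ : 5 * j.+1 = 4 + (5 * j + 1))%N; last lia.
by rewrite big_mkord big_split_ord !big_ord_recl big_ord0 /= addr0 !addrA.
Qed.

Lemma pv_residue_sum f g : eq5 f g -> pv 1 (g 1%N + g 2 + g 3) -> pv 1 (f 1%N + f 2 + f 3).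
Proof.
move=> [h ->] [b gb]; exists (b + h 1%N + h 2 + h 3).
rewrite !fpsDE !fps_natME; transitivity (g 1%N + g 2 + g 3 + 5%:R * (h 1%N + h 2 + h 3)); first by
  ring.
by rewrite gb; ring.
Qed.

Lemma act_ua c : even_bound c -> odd_bound (fps_act ua c).
Proof.
move=> ec; split.
- by rewrite fps_actE big1 // => m _; rewrite ua_0 mulr0.
(* The offset 13 is 10 from [ua], minus 2 from [even_bound], plus at most 5 lost in the floor. *)
- move=> j k lek; rewrite fps_actE; apply: pv_sum => m _.
  have [leka|ltak] := leqP k ((m + 2) %/ 6); last first.
    apply: (@pvM ((m + 2) %/ 6) (k - (m + 2) %/ 6)); first by lia.
      by apply: ec; lia.
    by apply: pv_ua; lia.
  by rewrite mulrC; apply: pvMr; apply: ec; lia.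
(* From index 4 on, [c] is divisible by 5, so only four residues of [ua] matter. *)
have rest j : pv 1 (\sum_(m < 5 * j + 1) c (4 + m)%N * ua (4 + m)%N j).
  by apply: pv_sum => m _; rewrite mulrC; apply: pvMr; apply: ec; lia.
rewrite !fps_act_split; set r1 := \sum_(m < _) _; set r2 := \sum_(m < _) _.
set r3 := \sum_(m < _) _.
have [u0 u1 u2 u3] := ua_residues.
have -> : forall (c0 c1 c2 c3 a1 a2 a3 b1 b2 b3 d1 d2 d3 e1 e2 e3 : int),
  c0 * a1 + c1 * b1 + c2 * d1 + c3 * e1 + r1 + (c0 * a2 + c1 * b2 + c2 * d2 + c3 * e2 + r2) +
  (c0 * a3 + c1 * b3 + c2 * d3 + c3 * e3 + r3) =
  c0 * (a1 + a2 + a3) + c1 * (b1 + b2 + b3) + c2 * (d1 + d2 + d3) + c3 * (e1 + e2 + e3) +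
  (r1 + r2 + r3) by move=> *; ring.
apply: pvD; last by do ?apply: pvD; apply: rest.
do 3?[apply: pvD]; apply: pvMr.
- by apply: pv_residue_sum u0 _; exists 1; rewrite !fpsDE !fps_natME !fpsXnE coefsE.
- by apply: pv_residue_sum u1 _; exists 1; rewrite !fpsDE !fps_natME !fpsXnE.
- by apply: pv_residue_sum u2 _; exists 0; rewrite !fps0E.
- by apply: pv_residue_sum u3 _; exists 1; rewrite !fpsDE !fps_natME !fpsXnE.
Qed.

(** The terms of index 4 and more gain the factor 5 from the slopes; those of index 1 to 3 need the
    linear condition when [j] is small. *)
Lemma act_um_pv c j k : odd_bound c -> (6 * k <= j + 2)%N -> pv k.+1 (fps_act um c j).
Proof.
move=> [c0 sc [b cb]] lek; rewrite fps_act_split c0 mul0r add0r; apply: pvD; last first.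
  apply: pv_sum => m _; set M := (4 + m)%N.
  have [leka|ltak] := leqP k.+1 ((5 * M - 13) %/ 6).
    by rewrite mulrC; apply: pvMr; apply: sc; lia.
  apply: (@pvM ((5 * M - 13) %/ 6) (k.+1 - (5 * M - 13) %/ 6)); first by lia.
    by apply: sc; rewrite /M; lia.
  by apply: pv_um; rewrite /M in ltak *; lia.
(* For [j >= 3] the bound on [um] alone gives [k.+1]. *)
have [le3j|ltj3] := leqP 3 j.
  by do 2?[apply: pvD]; apply: pvMr; apply: pv_um; lia.
(* Here [j <= 2]; modulo 5 the three series [um] coincide, so the sum [c 1 + c 2 + c 3] factors
   out. *)
have -> : k = 0%N by lia.
have [u1 u2 u3] := um_residues.
have [b1 ->] := eq5_coef j u1; have [b2 ->] := eq5_coef j u2; have [b3 ->] := eq5_coef j u3.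
exists (b * fpsX j + c 1%N * b1 + c 2 * b2 + c 3 * b3); rewrite expr1 in cb *.
transitivity ((c 1%N + c 2 + c 3) * fpsX j + 5%:R * (c 1%N * b1 + c 2 * b2 + c 3 * b3)).
  by ring.
by rewrite cb; ring.
Qed.

Lemma U_U_AA c : even_bound c ->
  exists2 d, even_bound d & U (U (AA * K c)) = 5%:R * K d.
Proof.
move=> ec; have oc := act_ua ec; have U1 := U_act (fps_act ua c) U_ss.
(* An exact division, by [act_um_pv]. *)
pose d : fps int := Fps (fun m => (fps_act um (fps_act ua c) m %/ 5)%Z).
have dE m k b : fps_act um (fps_act ua c) m = 5%:R ^+ k.+1 * b -> d m = 5%:R ^+ k * b.
  by rewrite /d coefsE exprS -mulrA => ->; rewrite mulKz.
exists d.
  by move=> m k lek; have [b /dE] := act_um_pv oc lek; exists b.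
rewrite (U_act c U_AAE) -[K (fps_act ua c)]mul1r U1 -[5%:R](rmorph_nat K 5) -rmorphM /=.
congr K; apply: fpsP => m; rewrite fps_natME.
have [//|b E] := act_um_pv (k := 0) (j := m) oc.
by rewrite (dE _ _ _ E) E expr1 mul1r.
Qed.

(** * Iterated sections of the generating function *)

Definition cubic_gf : fps int := fps_inv (euler int * dil 2 (euler int) ^+ 2).

(** One step picks the coefficient of index 25 n - 5, or 0 for n = 0; read at index n + 1, this is
    25 n + 20. *)
Definition cubic_sec (k : nat) : fps int := iter k (fun f => U (fpsX * U f)) cubic_gf.

(** [AA] times f_1 f_2^2 is a series in q^5, so it passes through the inner [U]; what remains is q
    times f_5 f_10^2, and the latter passes through the outer one. *)
Lemma cubic_sec_step f :
  euler int * dil 2 (euler int) ^+ 2 * U (fpsX * U f) =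
  U (U (AA * (euler int * dil 2 (euler int) ^+ 2 * f))).
Proof.
rewrite [AA * _]mulrA AA_euler.
have -> : fpsX ^+ 5 * (dil 25 (euler int) * dil 50 (euler int) ^+ 2) * f =
    dil 5 (fpsX * (dil 5 (euler int) * dil 10 (euler int) ^+ 2)) * f.
  rewrite [dil 5 (fpsX * _)]dilM [dil 5 (_ * _)]dilM [dil 5 (_ ^+ 2)]rmorphXn /=.
  by rewrite dilX // !dil_dil.
rewrite U_dil; set W := _ * dil 10 _ ^+ 2.
have -> : fpsX * W * U f = W * (fpsX * U f) by ring.
rewrite /W.
have -> : dil 5 (euler int) * dil 10 (euler int) ^+ 2 = dil 5 (euler int * dil 2 (euler int) ^+ 2).
  by rewrite [RHS]dilM [dil 5 (_ ^+ 2)]rmorphXn /= dil_dil.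
by rewrite U_dil.
Qed.

Lemma cubic_sec_K k : exists2 c, even_bound c &
  euler int * dil 2 (euler int) ^+ 2 * cubic_sec k = 5%:R ^+ k * K c.
Proof.
elim: k => [|k [c ec IH]].
  exists 1; last by rewrite expr0 mul1r rmorph1 [LHS]fps_mulfV // eul_eul2_0E.
  move=> m k lek; rewrite fps1E; case: eqP => [m0|_]; last exact: pv0.
  have -> : k = 0%N by lia.
  exact: pv_0.
have [d ed E] := U_U_AA ec; exists d => //.
rewrite /cubic_sec iterS -/(cubic_sec k) cubic_sec_step IH mulrCA.
have nat_dil : 5%:R ^+ k = dil 5 (5%:R ^+ k) :> fps int by rewrite rmorphXn rmorph_nat.
by rewrite nat_dil U_dil {1}nat_dil U_dil E exprSr mulrA.
Qed.

Lemma cubic_sec_pv k n : pv k (cubic_sec k n).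
Proof.
have [c _ E] := cubic_sec_K k; set w := euler int * _ in E.
have -> : cubic_sec k = 5%:R ^+ k * (fps_inv w * K c).
  rewrite mulrCA -E mulrA [_ * w]mulrC fps_mulfV ?mul1r //; exact: eul_eul2_0E.
by exists ((fps_inv w * K c) n); rewrite -natrX fps_natME natrX.
Qed.

(** 1 + 19 (25^k - 1) / 24 without division; it starts at 1 because [cubic_sec] is read at
    [n.+1]. *)
Fixpoint shift25 (k : nat) : nat :=
  if k is k'.+1 then (shift25 k' + 19 * 25 ^ k')%N else 1%N.

Lemma cubic_secE k n : cubic_sec k n.+1 = cubic_gf (25 ^ k * n + shift25 k)%N.
Proof.
elim: k n => [|k IH] n; first by rewrite mul1n addn1.
rewrite /cubic_sec iterS -/(cubic_sec k) dissectE addn0.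
rewrite (_ : 5 * n.+1 = (5 * n + 4).+1)%N; last lia.
rewrite fpsXME dissectE addn0 (_ : 5 * (5 * n + 4) = (25 * n + 19).+1)%N; last lia.
by rewrite IH /= expnS; congr (coefs _ _); lia.
Qed.

Lemma shift25_gamma k : shift25 k.+1 = gamma k.+1.
Proof.
have [t [tE sE]] : exists t, (25 ^ k = 24 * t + 1)%N /\ (shift25 k = 19 * t + 1)%N.
  elim: k => [|k [t [tE sE]]]; first by exists 0%N.
  by exists (25 * t + 1)%N; rewrite expnS /= tE sE; split; lia.
rewrite /gamma (_ : k.+1 - 1 = k)%N; last lia.
by rewrite /= sE tE addnK mulnCA mulKn //; lia.
Qed.

(** * The generating function of the cubic partitions *)

Lemma geometric (R : comNzRingType) (x : R) n :
  (1 - x) * \sum_(m < n.+1) x ^+ m = 1 - x ^+ n.+1.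
Proof. by rewrite -(opprB x 1) mulNr -subrX1 opprB. Qed.

Lemma eqX1_prod (R : comNzRingType) N (I : Type) (r : seq I) (P : pred I) (F : I -> fps R) :
  (forall i, P i -> eqX N (F i) 1) -> eqX N (\prod_(i <- r | P i) F i) 1.
Proof.
by move=> F1; elim/big_rec: _ => // i f /F1 Fi f1; rewrite -[1]mulr1; apply: eqXM.
Qed.

Lemma even_factors (n : nat) :
  \prod_(i < n) (if odd i.+1 then 1 else 1 - fpsX ^+ i.+1) =
  dil 2 (qpoch (fpsX : fps int) n./2).
Proof.
elim: n => [|n IH]; first by rewrite /qpoch !big_ord0 rmorph1.
rewrite big_ord_recr IH /= uphalf_half; case: ifPn => [/negbTE -> | /negPn odd_n].
  by rewrite mulr1.
rewrite odd_n add1n /qpoch [in RHS]big_ord_recr /= dilM dilB dil1 rmorphXn /= dilX // -exprM.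
by congr (_ * (1 - _ ^+ _)); have := odd_double_half n; rewrite odd_n; lia.
Qed.

Lemma num_cubic_partitions_gf n : (num_cubic_partitions 3 n)%:R = cubic_gf n.
Proof.
pose ok (p : 'I_n.+1 * 'I_3) (m : 'I_n.+1) := (0 < m)%N ==> coloured_part p.1 p.2.
pose F p m : fps int := if ok p m then fpsX ^+ (p.1 * m) else 0.
(* By distributivity the product expands into a sum over all multiplicity functions, and [ok] kills
   those that use a forbidden part. *)
have -> : (num_cubic_partitions 3 n)%:R = (\prod_p \sum_m F p m) n.
  rewrite bigA_distr_bigA fps_sumE /num_cubic_partitions cardsE -sum1_card natr_sum big_mkcond.
  apply: eq_bigr => m _; rewrite unfold_in /cubic_partition.
  rewrite -[[forall p, _]]/[forall p, ok p (m p)].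
  have [/forallP okm | nokm] /= := boolP [forall p, ok p (m p)].
    rewrite (eq_bigr (fun p : 'I_n.+1 * 'I_3 => fpsX ^+ (p.1 * m p))) => [|p _]; last first.
      by rewrite /F okm.
    rewrite -(big_morph (fun k => fpsX ^+ k) (exprD fpsX) (expr0 fpsX)).
    by rewrite fpsXnE eq_sym; case: eqP.
  have [p nokp] : exists p, ~~ ok p (m p).
    by move: nokm; rewrite negb_forall => /existsP.
  by rewrite (bigD1 p) //= /F (negbTE nokp) mul0r.
pose G (p : 'I_n.+1 * 'I_3) : fps int := if coloured_part p.1 p.2 then 1 - fpsX ^+ p.1 else 1.
(* For an allowed part the geometric sum leaves an error of degree at least [n.+1]; for a forbidden
   one only [m = 0] contributes. *)
have FG : eqX n.+1 (\prod_p G p * \prod_p \sum_m F p m) 1.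
  rewrite -big_split; apply: eqX1_prod => p _ /=; rewrite /G; case: ifPn => col.
    rewrite (eq_bigr (fun m : 'I_n.+1 => (fpsX ^+ p.1) ^+ m)) => [|m _]; last first.
      by rewrite /F /ok col implybT exprM.
    rewrite geometric -[X in eqX _ _ X]subr0; apply: eqXD => //.
    rewrite -exprM => j ltj; rewrite !fpsNE (@eqX0_Xn _ n.+1) //; move: col.
    by rewrite /coloured_part; have := ltn_ord p.1; nia.
  rewrite mul1r (bigD1 ord0) //= big1 ?addr0 /F /ok //= => [|m m0].
    by rewrite muln0 expr0.
  by rewrite (negbTE col) implybF -eqn0Ngt ifN.
(* Size 0 gives 1, odd sizes one factor, even sizes three, of which one belongs to f_1 and two to
   f_2^2. *)
have GE : \prod_p G p = qpoch fpsX n * dil 2 (qpoch fpsX n./2) ^+ 2.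
  rewrite -even_factors -(pair_bigA _ (fun k c => G (k, c))) /= big_ord_recl.
  rewrite [X in X * _]big1 ?mul1r => [|c _]; last by [].
  rewrite -prodrXl -big_split; apply: eq_bigr => i _ /=.
  rewrite !big_ord_recl big_ord0 /G /coloured_part lift0 /=.
  by case: (odd i); rewrite /= ?mulr1 ?expr1n ?mulr1 //; ring.
apply: (fun f => eqX_mulfI eul_eul2_0E f (ltnSn n)).
rewrite fps_mulfV ?eul_eul2_0E //; apply: eqX_trans FG; apply: eqXM => //.
rewrite GE; apply: eqXM; first by apply/eqX_sym/qpoch_eqX.
apply/eqX_sym/eqX_exp/(@eqX_leq _ _ (2 * (n./2).+1)); last exact/eqX_dil/qpoch_eqX.
by have := odd_double_half n; case: (odd n); lia.
Qed.

Local Close Scope ring_scope.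

Theorem theorem1p1 (alpha n : nat) (alpha_ge1 : 1 <= alpha) :
  num_cubic_partitions 3 (5 ^ (2 * alpha) * n + gamma alpha) = 0 %[mod 5 ^ alpha].
Proof.
case: alpha alpha_ge1 => // a _.
(* The coefficient at [n.+1] is a_3 at 25^alpha n + gamma_alpha. *)
have [b] := cubic_sec_pv a.+1 n.+1.
rewrite cubic_secE -num_cubic_partitions_gf shift25_gamma (_ : 25 = 5 ^ 2) // -expnM.
set N := num_cubic_partitions _ _ => E.
have : (Posz (5 ^ a.+1) %| Posz N)%Z.
  by apply/dvdzP; exists b; rewrite -!natz E mulrC natrX.
by rewrite dvdzE !absz_nat mod0n => /eqP.
Qed.
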